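(* Let $\rho$ be an integer and put $m=|\rho|$. Then the fundamental matrix solution $W(z)$ of the equation $$\frac{\partial W(z)}{\partial z_1}=\rho A_1(z)W(z),\qquad A_1(z)=\sum_{k=2}^{n}\frac{P_{1,k}}{z_1-z_k},$$ can be written in the form $$W(z)=\sum_{k=2}^{n}\sum_{j=1}^{m}\frac{L_{k,j}(\xi)}{(z_1-z_k)^j}+Q(z),$$ where $\xi=[z_2,\dots,z_n]$, the $L_{k,j}(\xi)$ are $n\times n$ matrix functions of $\xi$, and $Q(z)$ is an $n\times n$ matrix polynomial with respect to $z_1$ (with coefficients that are functions of $\xi$) with $$\deg Q(z)=m(n-1)\ \text{ if }\rho>0,\qquad \deg Q(z)=m\ \text{ if }\rho<0 .$$
   Context: $z=[z_1,\dots,z_n]$ are complex variables with $z_k\neq z_\ell$ for $k\neq\ell$. For $i\ne j$, $P_{i,j}=P_{j,i}$ is the $n\times n$ permutation matrix of the transposition $(i;j)$ in the natural representation of the symmetric group $S_n$: its $(i,j)$ and $(j,i)$ entries are $1$, its $(k,k)$ entries are $1$ for $k\ne i,j$, and all other entries are $0$. A fundamental matrix solution is an $n\times n$ matrix solution whose columns are linearly independent solutions. The degree $\deg Q$ is the degree of $Q$ as a matrix polynomial in $z_1$. *)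

(* Defs.v *)
From mathcomp Require Import all_boot all_order all_algebra.
From mathcomp Require Export complex.
From mathcomp Require Import all_classical all_reals all_analysis.
Import numFieldNormedType.Exports.

Set Implicit Arguments.
Unset Strict Implicit.
Unset Printing Implicit Defensive.

Import Order.TTheory GRing.Theory Num.Theory.
Local Open Scope ring_scope.

(* The number of variables, written n in the mathematical text, is n.+1 here,
   so that square matrices form a ring and ord0 is the index of z_1; the
   indices 2, ..., n of the text are the k : 'I_n.+1 with k != ord0. *)

Definition distinct_coords (R : realType) (n : nat) (z : 'rV[R[i]]_n) : Prop :=
  injective (z ord0).

(* [z_2, ..., z_n] *)
Definition xi_of (R : realType) (n : nat) (z : 'rV[R[i]]_n.+1) : 'rV[R[i]]_n :=
  col' ord0 z.

Definition A1 (R : realType) (n : nat) (z : 'rV[R[i]]_n.+1) : 'M[R[i]]_n.+1 :=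
  \sum_(k : 'I_n.+1 | k != ord0)
    (z ord0 ord0 - z ord0 k)^-1 *: tperm_mx ord0 k.

(* The scalars are R[i], so the derivative along the first basis vector is the
   complex partial derivative with respect to z_1. *)
Definition matrix_solution (R : realType) (n : nat) (rho : int)
    (W : 'rV[R[i]]_n.+1 -> 'M[R[i]]_n.+1) : Prop :=
  forall z : 'rV[R[i]]_n.+1, distinct_coords z ->
    is_derive z (delta_mx ord0 ord0 : 'rV[R[i]]_n.+1) W
      (rho%:~R *: A1 z *m W z).

(* The equation is an ODE in z_1 with parameters xi: independence is that of
   the columns as functions of z_1, for each value of the parameters, and the
   entries of c are the coefficients of a vanishing linear combination. *)
Definition independent_columns (R : realType) (n : nat)
    (W : 'rV[R[i]]_n.+1 -> 'M[R[i]]_n.+1) : Prop :=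
  forall xi : 'rV[R[i]]_n, distinct_coords xi ->
  forall c : 'I_n.+1 -> R[i],
    (forall z : 'rV[R[i]]_n.+1, distinct_coords z -> xi_of z = xi ->
       \sum_j c j *: col j (W z) = 0) ->
    forall j, c j = 0.

Definition fundamental_solution (R : realType) (n : nat) (rho : int)
    (W : 'rV[R[i]]_n.+1 -> 'M[R[i]]_n.+1) : Prop :=
  matrix_solution rho W /\ independent_columns W.

(* Main.v *)
(* Write W = prod_k (z_1 - z_k)^rho u.  Then
   (z_1 - z_j) u_j' = rho (u_1 - u_j) for j <> 1, and the sum of the u_j is
   constant.  For rho = m > 0 a basis of solutions is given by the vector of
   ones together with, for each k <> 1, a solution
   sum_(e <= m) v_e (z_1 - z_k)^(e - 2m), whose coefficients come from a
   recursion that terminates.  Let M be the polynomial matrix with these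
   columns, the k-th one multiplied by (z_1 - z_k)^(2m).  A solution u
   that is regular at a point and zero there vanishes identically, hence M is
   invertible at every point, det M is a nonzero constant, and the inverse of
   M is polynomial.
   The P_(1,k) being symmetric, inverse transposition exchanges rho and - rho,
   and this yields a polynomial u for rho = - m as well.  The pole orders are
   then visible, and the degree at infinity comes from the exponents of the
   system in u there: for rho < 0 they are 0, m and mn, and the last one
   occurs because some column of u vanishes to order 2m > m at z_k.
   Any other fundamental solution is W C with C invertible and independent of
   z_1, because the plane minus finitely many points is connected. *)
Require Import Defs.
From mathcomp Require Import all_boot all_order all_algebra.
From mathcomp Require Import all_classical all_reals all_analysis.
From mathcomp Require Import perm ring zify.
Import numFieldNormedType.Exports.
Import Order.TTheory GRing.Theory Num.Theory.
Local Open Scope ring_scope.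
Set Implicit Arguments.
Unset Strict Implicit.
Unset Printing Implicit Defensive.

Local Open Scope classical_set_scope.

(** * Complex derivatives *)

Lemma is_deriveE (K : numFieldType) (V W : normedModType K) (x v : V)
    (f : V -> W) (df : W) :
  is_derive x v f df <->
  (fun h : K => h^-1 *: (f (h *: v + x) - f x)) @ 0^' --> df.
Proof.
split=> [[fx <-]|h]; first exact: fx.
by split; [apply/cvg_ex; exists df | apply/cvg_lim].
Qed.

Lemma is_derive_mxP (K : numFieldType) (V : normedModType K) (m n : nat)
    (x v : V) (M : V -> 'M[K]_(m, n)) (dM : 'M[K]_(m, n)) :
  is_derive x v M dM <->
  forall i j, is_derive x v (fun y => M y i j) (dM i j).
Proof.
split=> [/is_deriveE/cvg_ballP hM i j | hM].
  apply/is_deriveE/cvg_ballP => e e0.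
  have := hM e e0; apply: filterS => h [_ /(_ i j)].
  by rewrite !mxE.
apply/is_deriveE/cvg_ballP => e e0.
suff: \forall h \near 0^', forall i j, ball (dM i j) e
    ((h^-1 *: (M (h *: v + x) - M x)) i j).
  by apply: filterS => h; split.
apply: filter_forall => i; apply: filter_forall => j.
have /is_deriveE/cvg_ballP/(_ e e0) := hM i j.
by apply: filterS => h; rewrite !mxE.
Qed.

Lemma is_derive_horner (K : numFieldType) (p : {poly K}) (x : K) :
  is_derive x 1 (horner p) p^`().[x].
Proof.
elim/poly_ind: p => [|p c ih].
  rewrite deriv0 horner0; have -> : horner (0 : {poly K}) = cst 0.
    by apply/funext => y; rewrite horner0.
  exact: is_derive_cst.
have -> : horner (p * 'X + c%:P) = horner p * id + cst c.
  by apply/funext => y; rewrite !fctE !hornerE.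
rewrite derivMXaddC.
apply: (is_derive_eq (is_deriveD (is_deriveM ih (is_derive_id _ _)) (is_derive_cst _ _ _))).
rewrite !hornerE /= ?addr0 /GRing.scale /= ?mulr1.
by rewrite [x * _]mulrC.
Qed.

(** * Constancy of functions with zero complex derivative *)

Lemma normr_Re_Im (R : rcfType) (z : R[i]) :
  `|complex.Re z|%:C%C <= `|z| /\ `|complex.Im z|%:C%C <= `|z|.
Proof.
case: z => a b; rewrite normc_def /= !lecR -!sqrtr_sqr.
by split; apply: ler_wsqrtr; rewrite ?lerDl ?lerDr ?sqr_ge0.
Qed.

(** The real difference quotient of [g] at step [h] is [phi] of [d] times the complex quotient of
    [f] at step [h * d], and [phi] does not increase norms. The intended [phi] are the real and
    imaginary parts. *)
Lemma is_derive_along (R : realType) (g : R -> R) (phi : R[i] -> R)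
    (f : R[i] -> R[i]) (p d : R[i]) (t : R) :
  (forall z w, phi (z + w) = phi z + phi w) ->
  (forall (c : R) z, phi (c%:C%C * z) = c * phi z) ->
  (forall z, `|phi z|%:C%C <= `|z|) ->
  @is_derive R[i] (R[i] : numFieldType) (R[i] : numFieldType) (p + t%:C%C * d) 1 f 0 ->
  (forall s, g s = phi (f (p + s%:C%C * d))) ->
  is_derive t 1 g 0.
Proof.
move=> phiD phiZ phi_le /is_deriveE/cvgrPdist_lt df gE.
have phiN z : phi (- z) = - phi z.
  by rewrite -mulN1r; have := phiZ (-1) z; rewrite rmorphN rmorph1 => ->; rewrite mulN1r.
have [d0|d0] := eqVneq d 0.
  have -> : g = cst (phi (f p)).
    by apply/funext => s; rewrite gE d0 mulr0 addr0.
  exact: is_derive_cst.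
apply/is_deriveE/cvgrPdist_lt => e e0.
have e0' : 0 < e%:C%C / `|d| :> R[i] by rewrite divr_gt0 ?normr_gt0 // ltcR.
have [r /= r0 hr] := df _ e0'.
have rd : 0 < r / `|d| by rewrite divr_gt0 ?normr_gt0.
have rdE : (complex.Re (r / `|d|))%:C%C = r / `|d|.
  by apply/RRe_real/gtr0_real.
have rd0 : 0 < complex.Re (r / `|d|) by rewrite -ltcR rdE.
exists (complex.Re (r / `|d|)) => //= h /=; rewrite sub0r normrN => hlt h0.
have hd0 : h%:C%C * d != 0 :> R[i].
  by rewrite mulf_neq0 // fmorph_eq0.
have := hr (h%:C%C * d); rewrite /= !sub0r !normrN => /(_ _ hd0).
have -> : `|h%:C%C * d| < r.
  rewrite normrM -ltr_pdivlMr ?normr_gt0 // -rdE.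
  by rewrite [`|h%:C%C|](_ : _ = `|h|%:C%C) ?ltcR // normc_def /= expr0n addr0 sqrtr_sqr.
move=> /(_ isT) hf; rewrite -ltcR.
apply: le_lt_trans (_ : _ <= `|d * ((h%:C%C * d)^-1 *:
    (f (h%:C%C * d *: 1 + (p + t%:C%C * d)) - f (p + t%:C%C * d)))|) _; last first.
  rewrite normrM mulrC -ltr_pdivlMr ?normr_gt0 //.
apply: le_trans (phi_le _); rewrite lecR le_eqVlt; apply/orP; left; apply/eqP.
congr (`| _ |); rewrite !gE.
have -> : d * ((h%:C%C * d)^-1 *: (f (h%:C%C * d *: 1 + (p + t%:C%C * d)) - f (p + t%:C%C * d)))
  = (h^-1)%:C%C * (f (h%:C%C * d *: 1 + (p + t%:C%C * d)) - f (p + t%:C%C * d)).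
  rewrite /GRing.scale /= invfM mulrCA !mulrA; congr (_ * _).
  rewrite -mulrA mulVf // mulr1 fmorphV //.
rewrite phiZ phiD phiN; congr (_ * (phi (f _) - _)).
by rewrite /GRing.scale /= !mulr1 rmorphD mulrDl addrCA.
Qed.

(** The mean value theorem is a real statement, so it is applied to the real and imaginary parts of
    [f] along the segment. *)
Lemma segment_const (R : realType) (f : R[i] -> R[i]) (p d : R[i]) :
  (forall t : R, 0 <= t <= 1 ->
     @is_derive R[i] (R[i] : numFieldType) (R[i] : numFieldType)
       (p + t%:C%C * d) 1 f 0) ->
  f (p + d) = f p.
Proof.
move=> df.
suff H (phi : R[i] -> R) : (forall z w, phi (z + w) = phi z + phi w) ->
  (forall (c : R) z, phi (c%:C%C * z) = c * phi z) ->
  (forall z, `|phi z|%:C%C <= `|z|) -> phi (f (p + d)) = phi (f p).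
  apply/eqP; rewrite eq_complex; apply/andP; split; apply/eqP; apply: H.
  - by move=> [? ?] [? ?].
  - by move=> c [? ?] /=; rewrite mul0r subr0.
  - by move=> z; case: (normr_Re_Im z).
  - by move=> [? ?] [? ?].
  - by move=> c [? ?] /=; rewrite mul0r addr0.
  - by move=> z; case: (normr_Re_Im z).
move=> phiD phiZ phi_le.
pose g (t : R) := phi (f (p + t%:C%C * d)).
have dg (t : R) : 0 <= t <= 1 -> is_derive t 1 g 0.
  by move=> t01; apply: (is_derive_along phiD phiZ phi_le (df t t01)).
have [|t tI|c _] := @MVT_segment R g (cst 0) 0 1 ler01.
- by move=> x; rewrite in_itv /= => /andP[x0 x1]; apply: dg; rewrite !ltW.
- by apply: derivable_within_continuous => x; rewrite in_itv /= => xI; case: (dg x xI).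
by rewrite /= mul0r /g rmorph0 rmorph1 mul0r mul1r addr0 => /eqP; rewrite subr_eq0 => /eqP.
Qed.

Lemma norm_sum_notin (K : numFieldType) (s : seq K) :
  1 + \sum_(y <- s) `|y| \notin s.
Proof.
apply/negP => h; set x := 1 + _ in h.
have : `|x| <= \sum_(y <- s) `|y|.
  by rewrite (perm_big _ (perm_to_rem h)) big_cons /= lerDl sumr_ge0.
have s0 : 0 <= \sum_(y <- s) `|y| by rewrite sumr_ge0.
by rewrite ger0_norm ?addr_ge0 // -subr_ge0 opprD addrCA subrr addr0 oppr_ge0 ler10.
Qed.

(* Any two points of a finitely punctured plane are joined by a path
   consisting of two segments: each puncture forbids at most two values of
   the imaginary part [tau] of the corner. *)
Lemma punctured_plane_const (R : realType) (s : seq R[i]) (f : R[i] -> R[i]) :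
  (forall x : R[i], x \notin s ->
     @is_derive R[i] (R[i] : numFieldType) (R[i] : numFieldType) x 1 f 0) ->
  forall x y : R[i], x \notin s -> y \notin s -> f x = f y.
Proof.
move=> df x y xs ys.
have [->//|xy] := eqVneq x y.
pose d := y - x; have d0 : d != 0 by rewrite subr_eq0 eq_sym.
pose w a := (a - x) / d.
have wE a : a = x + w a * d by rewrite /w divfK // addrCA subrr addr0.
(* In the coordinate [w], where [x] is 0 and [y] is 1, the corner is [1/2 + i tau]. Away from [x]
   and [y], a point of the first leg satisfies [tau = Im / (2 Re)] and one of the second leg
   [tau = Im / (2 (1 - Re))]; [l] collects these values over the punctures. *)
pose l := [seq complex.Im (w a) / (2 * complex.Re (w a)) | a <- s] ++
          [seq complex.Im (w a) / (2 * (1 - complex.Re (w a))) | a <- s].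
have [tau] : exists tau, tau \notin l by eexists; apply: norm_sum_notin.
rewrite mem_cat negb_or => /andP[tau1 tau2].
pose c := (2^-1 +i* tau)%C * d : R[i].
have <- : f (x + c) = f x.
  apply: segment_const => t t01; apply: df; apply/negP => h.
  move: (h) => /(map_f (fun a => complex.Im (w a) / (2 * complex.Re (w a)))).
  apply/negP; set wp := w _.
  suff -> : complex.Im wp / (2 * complex.Re wp) = tau by [].
  rewrite {}/wp.
  rewrite /w /c addrAC subrr add0r !mulrA mulfK //= !mul0r subr0 addr0.
  have t0 : t != 0 by apply: contraTneq h => ->; rewrite mul0r addr0.
  by field.
have -> : y = x + c + (d - c) by rewrite /d; ring.
apply/esym; apply: segment_const => t t01; apply: df; apply/negP => h.
move: (h) => /(map_f (fun a => complex.Im (w a) / (2 * (1 - complex.Re (w a))))).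
apply/negP; set p := _ + _ * _.
have -> : w p = ((1 - (1 - t) / 2) +i* ((1 - t) * tau))%C.
  have -> : p = x + (c + t%:C%C * (d - c)) by rewrite /p addrA.
  rewrite /w addrAC subrr add0r /c.
  have -> : (2^-1 +i* tau)%C * d + t%:C%C * (d - (2^-1 +i* tau)%C * d) =
     ((2^-1 +i* tau)%C + t%:C%C * (1 - (2^-1 +i* tau)%C)) * d by ring.
  rewrite mulfK //; apply/eqP; rewrite eq_complex /=; apply/andP; split; apply/eqP; by field.
rewrite /= subKr.
have t1 : 1 - t != 0.
  rewrite subr_eq0; apply: contraTneq h => <-; rewrite rmorph1.
  by have -> : x + c + 1 * (d - c) = y by rewrite /d; ring.
suff -> : (1 - t) * tau / (2 * ((1 - t) / 2)) = tau by [].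
by field.
Qed.
Local Close Scope classical_set_scope.

(** * The solutions with a single pole *)

(* The coefficients [v_e] of the solution [u = \sum_e v_e (x - a_k)^(e - 2m)].
   The system is resonant at [e = 0], whence the free initial vector, and the
   recursion stops by itself at [e = m] because [v_m] vanishes at [ord0]. *)
Fixpoint pole_coef (K : numFieldType) (n : nat) (a : 'I_n.+1 -> K) (m : nat)
    (k : 'I_n.+1) (e : nat) : 'I_n.+1 -> K :=
  if e is e'.+1 then
    let v := pole_coef a m k e' in
    let w i := (m%:R * v ord0 + (m%:R - e'%:R) * v i) /
               ((a i - a k) * (2 * m%:R - e'%:R - 1)) in
    let s := \sum_(i | (i != ord0) && (i != k)) w i in
    fun j => if j == ord0 then (m%:R - e%:R) * s / e%:R
             else if j == k then - (m%:R * s / e%:R) else w j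
  else fun j => (j == ord0)%:R - (j == k)%:R.

(** The entries at [ord0] and [k] are the solution of two linear equations: this zero sum, and
    [(e - m) v_k = m v_0], which is the [k]-th equation at order [e]. *)
Lemma pole_coef_sum (K : numFieldType) (n : nat) (a : 'I_n.+1 -> K) (m : nat)
    (k : 'I_n.+1) (e : nat) : k != ord0 -> \sum_j pole_coef a m k e j = 0.
Proof.
move=> k0; rewrite (bigD1 ord0) //= (bigD1 k) //=.
case: e => [|e] /=.
  rewrite big1 ?eqxx => [|i /andP[/negbTE -> /negbTE ->]]; last by rewrite subr0.
  by rewrite eq_sym (negbTE k0) subr0 sub0r addr0 subrr.
under [X in _ + (_ + X) = _]eq_bigr => i /andP[/negbTE -> /negbTE ->] do [].
by rewrite !eqxx (negbTE k0); field.
Qed.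

(** This is the coefficient of [(x - a_k)^(e - 2m)] in [(x - a_j) u_j' = m (u_0 - u_j)], with
    [x - a_j] rewritten as [(x - a_k) - (a_j - a_k)]. *)
Lemma pole_coef_rec (K : numFieldType) (n : nat) (a : 'I_n.+1 -> K) (m : nat)
    (k j : 'I_n.+1) (e : nat) : {in predC1 ord0 &, injective a} ->
  k != ord0 -> j != ord0 -> (e < m)%N ->
  (e%:R - 2 * m%:R) * pole_coef a m k e j -
    (a j - a k) * (e.+1%:R - 2 * m%:R) * pole_coef a m k e.+1 j =
  m%:R * (pole_coef a m k e ord0 - pole_coef a m k e j).
Proof.
move=> ainj k0 j0 em.
have [->|jk] := eqVneq j k.
  rewrite subrr !mul0r subr0.
  case: e em => [|e] em /=; rewrite !eqxx (negbTE k0).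
    rewrite eq_sym (negbTE k0) ?mulr0n ?mulr1n; ring.
  by field.
rewrite [pole_coef _ _ _ e.+1 _]/= (negbTE j0) (negbTE jk) -natr1.
field; apply/andP; split.
  (* Since [e < m], the denominator [2m - e - 1] is not zero. *)
  rewrite -(natrM _ 2) -addrA -opprD natr1 subr_eq0 eqr_nat; lia.
by rewrite subr_eq0; apply: contra jk => /eqP/ainj -> //; rewrite ?inE.
Qed.

Lemma pole_coef_last (K : numFieldType) (n : nat) (a : 'I_n.+1 -> K) (m : nat)
    (k : 'I_n.+1) : (0 < m)%N -> pole_coef a m k m ord0 = 0.
Proof. by case: m => // m _; rewrite /= subrr !mul0r. Qed.

(** [P j] is the numerator of [u_j] over [(x - a_k)^(2m)], and the second clause is the system
    cleared of denominators. The last clause records the initial vector of the recursion. *)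
Lemma pole_column (K : numFieldType) (n : nat) (a : 'I_n.+1 -> K) (m : nat)
    (k : 'I_n.+1) : {in predC1 ord0 &, injective a} -> k != ord0 -> (0 < m)%N ->
  exists P : 'I_n.+1 -> {poly K},
  [/\ forall j, (size (P j) <= m.+1)%N,
      forall j, j != ord0 ->
        ('X - (a j)%:P) * (('X - (a k)%:P) * (P j)^`() - P j *+ (2 * m)) =
        ('X - (a k)%:P) * (P ord0 - P j) *+ m,
      \sum_j P j = 0 &
      (P ord0).[a k] = 1 /\ (P k).[a k] = -1].
Proof.
move=> ainj k0 m0.
pose v := pole_coef a m k; pose p j := \poly_(e < m.+1) v e j.
pose X := 'X - (a k)%:P.
have pE j e : (p j)`_e = if (e < m.+1)%N then v e j else 0 by rewrite coef_poly.
have p0 j : (p j \Po X).[a k] = v 0 j.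
  by rewrite horner_comp !hornerE subrr horner_coef0 pE.
exists (fun j => p j \Po X); split.
- move=> j; rewrite (leq_trans (size_comp_poly_leq _ _)) // size_XsubC muln1.
  by case: (size _) (size_poly (m.+1) (fun e => v e j)) => // *; rewrite ltnS.
- move=> j j0.
  pose b := a j - a k.
  (* Coefficients are compared in the variable centred at [a k]; composition with [X] then returns
     to the original variable. *)
  have key : ('X - b%:P) * ('X * (p j)^`() - p j *+ (2 * m)) = 'X * (p ord0 - p j) *+ m.
    pose T := 'X * (p j)^`() - p j *+ (2 * m).
    have TE e : T`_e = (e%:R - 2 * m%:R) * (p j)`_e.
      rewrite coefB coefXM coefMn coef_deriv; case: e => [|e] /=.
        by rewrite mulrBl mulr0n mul0r -(natrM _ 2) mulr_natl.
      by rewrite mulrBl -(natrM _ 2) !mulr_natl.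
    apply/polyP => e; rewrite -/T mulrBl coefB coefXM coefCM coefMn coefXM.
    rewrite !TE; case: e => [|e] /=.
      (* At the lowest order, either [j = k] and [b = 0], or the initial vector vanishes at [j]. *)
      rewrite mul0rn !sub0r pE /= /b.
      have [->|jk] := eqVneq j k; first by rewrite subrr; ring.
      by rewrite /v /= (negbTE j0) (negbTE jk); ring.
    rewrite coefB !pE !ltnS; case: (ltngtP e m) => [em|em|->].
    + by have := pole_coef_rec ainj k0 j0 em; rewrite -/v -/b mulrA => ->; rewrite mulr_natl.
    + by rewrite !mulr0 !subrr mul0rn.
    + by rewrite /v pole_coef_last // mulr0 mulr0 subr0 sub0r -mulr_natl; ring.
  have := congr1 (comp_poly X) key.
  rewrite !(rmorphM, rmorphB, rmorphMn) /= !comp_polyX !comp_polyC.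
  have -> : X - ((a j)%:P - (a k)%:P) = 'X - (a j)%:P by rewrite /X; ring.
  rewrite deriv_comp derivXsubC mulr1 => ->.
  by [].
- rewrite -(raddf_sum (comp_poly X)); suff -> : \sum_j p j = 0 by exact: raddf0.
  apply/polyP => e; rewrite coef_sum coef0.
  under eq_bigr do rewrite pE.
  by case: (e < m.+1)%N; [apply: pole_coef_sum | rewrite big1].
- by rewrite !p0 /v /= !eqxx (negbTE k0) eq_sym (negbTE k0) subr0 sub0r.
Qed.

Lemma dvdp_all_eq0 (K : fieldType) (p : {poly K}) (x : K) :
  (forall r, ('X - x%:P) ^+ r %| p) -> p = 0.
Proof.
move=> h; apply/eqP; apply: contraT => p0.
by have := dvdp_leq p0 (h (size p)); rewrite size_exp_XsubC ltnn.
Qed.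

(* [u = Y / F] satisfies [(x - a_j) u_j' = m (u_0 - u_j)]. *)
Definition cleared_ode (K : numFieldType) (n : nat) (a : 'I_n.+1 -> K) (m : nat)
    (F : {poly K}) (Y : 'I_n.+1 -> {poly K}) : Prop :=
  forall j, j != ord0 ->
    ('X - (a j)%:P) * (F * (Y j)^`() - F^`() * Y j) = F * (Y ord0 - Y j) *+ m.

(** If the solution vanishes to order [r.+1] at [x], the equations and the zero sum kill the leading
    vector [Z] there, so the order increases without end. When [x = a k] they reduce to
    [(r + 1 + 2m) Z_k = 0]: the nonzero local exponent is [- 2m], which is negative. *)
Lemma cleared_ode_eq0 (K : numFieldType) (n : nat) (a : 'I_n.+1 -> K) (m : nat)
    (F : {poly K}) (Y : 'I_n.+1 -> {poly K}) (x : K) :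
  {in predC1 ord0 &, injective a} -> F.[x] != 0 -> cleared_ode a m F Y ->
  \sum_j Y j = 0 -> (forall j, (Y j).[x] = 0) -> forall j, Y j = 0.
Proof.
move=> ainj Fx odeY sumY Yx.
suff H r : forall j, ('X - x%:P) ^+ r.+1 %| Y j.
  move=> j; apply: (@dvdp_all_eq0 _ _ x) => -[|r]; last exact: H.
  by rewrite expr0 dvd1p.
elim: r => [|r ih] j; first by rewrite expr1 dvdp_XsubCl /root Yx.
have /(_ _)/dvdpP/cid h := ih.
pose Z i := sval (h i).
have YE i : Y i = Z i * ('X - x%:P) ^+ r.+1 by rewrite /Z; case: (h i).
suff Zx i : (Z i).[x] = 0.
  rewrite YE exprS dvdp_mul2r ?expf_neq0 ?polyXsubC_eq0 //.
  by rewrite dvdp_XsubCl /root Zx.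
have X0 : ('X - x%:P) ^+ r.+1 != 0 :> {poly K} by rewrite expf_neq0 ?polyXsubC_eq0.
have Xx0 : 'X - x%:P != 0 :> {poly K} by rewrite polyXsubC_eq0.
have X0' : ('X - x%:P) ^+ r != 0 :> {poly K} by rewrite expf_neq0 ?polyXsubC_eq0.
have odeZ k : k != ord0 ->
    ('X - (a k)%:P) * (F * (Z k *+ r.+1 + ('X - x%:P) * (Z k)^`()) -
      ('X - x%:P) * F^`() * Z k) = ('X - x%:P) * (F * (Z ord0 - Z k) *+ m).
  move=> k0; apply: (mulIf X0'); move: (odeY k k0).
  rewrite !YE !derivM deriv_exp derivXsubC mul1r /= exprS => e.
  by apply: etrans (etrans e _); ring.
have sumZ : \sum_k (Z k).[x] = 0.
  rewrite -horner_sum; suff -> : \sum_k Z k = 0 by rewrite horner0.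
  apply: (mulIf X0); rewrite mul0r mulr_suml; apply: etrans sumY.
  by apply: eq_bigr => k _; rewrite -YE.
have Z1 k : k != ord0 -> a k != x -> (Z k).[x] = 0.
  move=> k0 akx; have := congr1 (horner^~ x) (odeZ k k0).
  rewrite !hornerE hornerMn subrr !mul0r addr0 subr0 => e.
  have {e}/eqP : (x - a k) * (F.[x] * ((Z k).[x] * r.+1%:R)) = 0 by rewrite mulr_natr.
  rewrite !mulf_eq0 subr_eq0 eq_sym (negbTE akx) (negbTE Fx) pnatr_eq0 orbF.
  by move=> /eqP.
have Z2 k : k != ord0 -> (Z k).[x] = 0.
  move=> k0; have [akx|] := eqVneq (a k) x; last exact: Z1.
  have Z0k : (Z ord0).[x] = - (Z k).[x].
    apply/eqP; rewrite -addr_eq0; apply/eqP; move: sumZ.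
    rewrite (bigD1 ord0) //= (bigD1 k) //= big1 ?addr0 // => l /andP[l0 lk].
    apply: Z1 => //; rewrite -akx; apply: contra lk => /eqP/ainj -> //; exact: l0.
  (* When [a k = x] both sides carry the factor [X - x], which is cancelled before evaluating. *)
  have := odeZ k k0; rewrite akx => /(mulfI Xx0)/(congr1 (horner^~ x)).
  rewrite hornerMn !hornerE hornerMn subrr !mul0r addr0 subr0 Z0k => e.
  have {e}/eqP : F.[x] * ((Z k).[x] * (r.+1 + 2 * m)%:R) = 0.
    by apply: etrans (subrr (F.[x] * ((Z k).[x] *+ r.+1))); rewrite {2}e; ring.
  by rewrite !mulf_eq0 (negbTE Fx) pnatr_eq0 orbF => /eqP.
have [->|/Z2//] := eqVneq i ord0.
by move: sumZ; rewrite (bigD1 ord0) //= big1 ?addr0.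
Qed.

Lemma cleared_ode_sum (K : numFieldType) (n : nat) (a : 'I_n.+1 -> K) (m : nat)
    (F : {poly K}) (I : finType) (S : pred I) (Y : I -> 'I_n.+1 -> {poly K}) :
  (forall l, S l -> cleared_ode a m F (Y l)) ->
  cleared_ode a m F (fun j => \sum_(l | S l) Y l j).
Proof.
move=> h j j0; rewrite raddf_sum !mulr_sumr -sumrB mulr_sumr.
rewrite -sumrB mulr_sumr -sumrMnl; apply: eq_bigr => l Sl.
exact: h.
Qed.

Lemma cleared_odeZ (K : numFieldType) (n : nat) (a : 'I_n.+1 -> K) (m : nat)
    (F : {poly K}) (c : K) (Y : 'I_n.+1 -> {poly K}) :
  cleared_ode a m F Y -> cleared_ode a m F (fun j => c *: Y j).
Proof.
move=> h j j0; rewrite derivZ -!scalerAr -scalerBr -scalerAr h //.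
by rewrite -scalerBr -scalerAr scalerMnr.
Qed.

Lemma cleared_odeD (K : numFieldType) (n : nat) (a : 'I_n.+1 -> K) (m : nat)
    (F : {poly K}) (Y Z : 'I_n.+1 -> {poly K}) :
  cleared_ode a m F Y -> cleared_ode a m F Z ->
  cleared_ode a m F (fun j => Y j + Z j).
Proof.
move=> hY hZ j j0; rewrite derivD.
apply: etrans (etrans (congr2 +%R (hY j j0) (hZ j j0)) _); ring.
Qed.

Lemma cleared_ode_cst (K : numFieldType) (n : nat) (a : 'I_n.+1 -> K) (m : nat)
    (F : {poly K}) : cleared_ode a m F (fun=> F).
Proof. by move=> j _; rewrite mulrC [F * _]mulrC subrr mul0r subrr mulr0 mul0rn. Qed.

(** * The polynomial matrix of the basis solutions *)

Definition pole_mx (K : numFieldType) (n : nat) (a : 'I_n.+1 -> K) (m : nat)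
    (M : 'M[{poly K}]_n.+1) : Prop :=
  [/\ forall j, M j ord0 = 1,
      forall j k, k != ord0 -> (size (M j k) <= m.+1)%N,
      forall j k, k != ord0 -> j != ord0 ->
        ('X - (a j)%:P) * (('X - (a k)%:P) * (M j k)^`() - M j k *+ (2 * m)) =
        ('X - (a k)%:P) * (M ord0 k - M j k) *+ m,
      forall k, k != ord0 -> \sum_j M j k = 0 &
      forall k, k != ord0 -> (M ord0 k).[a k] = 1 /\ (M k k).[a k] = -1].

Lemma pole_mx_exists (K : numFieldType) (n : nat) (a : 'I_n.+1 -> K) (m : nat) :
  {in predC1 ord0 &, injective a} -> (0 < m)%N -> exists M, pole_mx a m M.
Proof.
move=> ainj m0.
have /choice[P hP] k : exists P : 'I_n.+1 -> {poly K}, k != ord0 ->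
  [/\ forall j, (size (P j) <= m.+1)%N,
      forall j, j != ord0 ->
        ('X - (a j)%:P) * (('X - (a k)%:P) * (P j)^`() - P j *+ (2 * m)) =
        ('X - (a k)%:P) * (P ord0 - P j) *+ m,
      \sum_j P j = 0 &
      (P ord0).[a k] = 1 /\ (P k).[a k] = -1].
  have [->|k0] := eqVneq k ord0; first by exists (fun=> 0).
  by have [P h] := pole_column ainj k0 m0; exists P.
exists (\matrix_(j, k) if k == ord0 then 1 else P k j); split.
- by move=> j; rewrite mxE.
- by move=> j k k0; rewrite mxE (negbTE k0); case: (hP k k0).
- by move=> j k k0 j0; rewrite !mxE (negbTE k0); case: (hP k k0) => _ + _ _; apply.
- move=> k k0; under eq_bigr do rewrite mxE (negbTE k0).
  by case: (hP k k0).
- by move=> k k0; rewrite !mxE (negbTE k0); case: (hP k k0).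
Qed.

(** Multiplying numerator and denominator by [G] does not change [u]; this brings different columns
    over a common denominator. *)
Lemma pole_mx_cleared_ode (K : numFieldType) (n : nat) (a : 'I_n.+1 -> K) (m : nat)
    (M : 'M[{poly K}]_n.+1) (k : 'I_n.+1) (G : {poly K}) :
  pole_mx a m M -> (0 < m)%N -> k != ord0 ->
  cleared_ode a m (('X - (a k)%:P) ^+ (2 * m) * G) (fun j => M j k * G).
Proof.
move=> [_ _ odeM _ _] m0 k0 j j0; set s := 'X - (a k)%:P.
have {odeM} := odeM j k k0 j0; rewrite -/s.
have [p ->] : exists p, (2 * m)%N = p.+1 by exists (2 * m).-1; lia.
move=> odeM; apply: etrans (etrans (congr1 ( *%R (s ^+ p * G * G)) odeM) _); last first.
  by rewrite exprS; ring.
by rewrite !derivM deriv_exp derivXsubC mul1r exprS /=; ring.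
Qed.

(** The columns with pole away from [x] combine into a solution [Y / F] regular at [x]. The given
    relation makes it vanish at [x], hence identically, and its expansion at each pole then returns
    the coefficients. *)
Lemma pole_mx_inj (K : numFieldType) (n : nat) (a : 'I_n.+1 -> K) (m : nat)
    (M : 'M[{poly K}]_n.+1) (x : K) (c : 'I_n.+1 -> K) :
  {in predC1 ord0 &, injective a} -> (0 < m)%N -> pole_mx a m M ->
  (forall j, \sum_k c k * (M j k).[x] = 0) -> forall k, c k = 0.
Proof.
move=> ainj m0 hM Mc.
have [M1 _ odeM sumM normM] := hM.
pose S := [pred k | (k != ord0) && (a k != x)].
pose s k := 'X - (a k)%:P.
pose F := \prod_(k | S k) s k ^+ (2 * m).
pose G l := \prod_(k | S k && (k != l)) s k ^+ (2 * m).
have FG l : S l -> F = s l ^+ (2 * m) * G l by move=> Sl; rewrite /F (bigD1 l).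
have Fx : F.[x] != 0.
  rewrite horner_prod; apply/prodf_neq0 => k /andP[_ akx].
  by rewrite horner_exp expf_neq0 // !hornerE subr_eq0 eq_sym.
have Gx l : S l -> F.[x] = (x - a l) ^+ (2 * m) * (G l).[x].
  by move=> /FG ->; rewrite hornerM horner_exp !hornerE.
have Ga l : S l -> (G l).[a l] != 0.
  move=> /andP[l0 _]; rewrite horner_prod; apply/prodf_neq0 => k /andP[/andP[k0 _] kl].
  rewrite horner_exp expf_neq0 // !hornerE subr_eq0; apply: contra kl => /eqP/ainj.
  by rewrite eq_sym => -> //.
(* With this scaling, [Y] at [x] is [F.[x]] times the part of the relation carried by [ord0] and
   [S]. *)
pose c' l := c l * (x - a l) ^+ (2 * m).
pose Y j := c ord0 *: F + \sum_(l | S l) c' l *: (M j l * G l).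
have odeY : cleared_ode a m F Y.
  apply: cleared_odeD; first by apply: cleared_odeZ; apply: cleared_ode_cst.
  apply: cleared_ode_sum => l Sl; apply: cleared_odeZ; rewrite (FG l Sl).
  by apply: pole_mx_cleared_ode => //; case/andP: Sl.
have Yx j : (Y j).[x] = F.[x] * \sum_(k | (k == ord0) || S k) c k * (M j k).[x].
  rewrite (bigD1 ord0) ?eqxx //= M1 hornerC mulr1 !hornerE horner_sum mulrDr.
  rewrite [_ * c _]mulrC mulr_sumr; congr (_ + _).
  apply: eq_big => [l|l /[dup] Sl].
    by rewrite /=; case: (l == ord0); rewrite ?andbF ?andbT.
  by move=> _; rewrite hornerZ hornerM (Gx l Sl) /c' /=; ring.
have sumY : \sum_j Y j = (c ord0 *+ n.+1) *: F.
  rewrite big_split /= sumr_const card_ord scalerMnl exchange_big /=.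
  rewrite big1 ?addr0 // => l /andP[l0 _].
  by rewrite -scaler_sumr -mulr_suml sumM // mul0r scaler0.
(* The relation makes [Y] at [x] a multiple of column [k], whose entries at [ord0] and [k] are [1]
   and [-1]. The [k]-th equation at [x = a k] forces these two entries of [Y] to agree, so the
   multiple is zero. *)
have c1 k : k != ord0 -> a k = x -> c k = 0.
  move=> k0 akx.
  have Mk j : (Y j).[x] = - (F.[x] * (c k * (M j k).[x])).
    rewrite Yx -mulrN; congr (_ * _); apply/eqP; rewrite -addr_eq0; apply/eqP.
    rewrite -[RHS](Mc j) [RHS](bigD1 k) //= addrC; congr (_ + _).
    apply: eq_bigl => l; have [->|l0] /= := eqVneq l ord0; first by rewrite eq_sym k0.
    by congr (~~ _); apply/eqP/eqP => [alx | -> //]; apply: ainj => //; rewrite alx.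
  have := congr1 (horner^~ x) (odeY k k0).
  rewrite akx hornerM hornerXsubC subrr mul0r hornerMn hornerM hornerD hornerN !Mk.
  move: (normM k k0); rewrite akx => -[-> ->] e.
  have {e}/eqP : F.[x] * F.[x] * (c k * (2 * m)%:R) = 0 by rewrite -[RHS]oppr0 [in RHS]e; ring.
  rewrite !mulf_eq0 (negbTE Fx) pnatr_eq0 muln_eq0 (gtn_eqF m0) /= ?orbF. by move=> /eqP.
have Y0x j : (Y j).[x] = 0.
  rewrite Yx (_ : \sum_(k | _) _ = 0) ?mulr0 //; apply: etrans (Mc j).
  rewrite [RHS](bigID (fun k => (k == ord0) || S k)) /= [X in _ + X]big1 ?addr0 // => k.
  rewrite negb_or => /andP[k0]; rewrite k0 /= negbK => /eqP akx.
  by rewrite (c1 k k0 akx) mul0r.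
(* Only the column of ones contributes to the sum of [Y]. *)
have c0 : c ord0 = 0.
  have := congr1 (horner^~ x) sumY; rewrite horner_sum big1 // hornerZ => /esym/eqP.
  by rewrite mulf_eq0 (negbTE Fx) orbF -mulr_natr mulf_eq0 pnatr_eq0 orbF => /eqP.
have Y0 : forall j, Y j = 0.
  by apply: (cleared_ode_eq0 ainj Fx odeY) => //; rewrite sumY c0 mul0rn scale0r.
move=> k; have [-> //|k0] := eqVneq k ord0.
have [akx|akx] := eqVneq (a k) x; first exact: c1.
have Sk : S k by rewrite /= k0 akx.
(* At [a k] every other [G l] has a vanishing factor, so only the term with [c k] survives. *)
have := congr1 (horner^~ (a k)) (Y0 ord0).
rewrite /Y c0 scale0r add0r horner0 horner_sum (bigD1 k) //= big1 => [|l /andP[Sl lk]].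
  have [M0 _] := normM k k0.
  rewrite addr0 hornerZ hornerM M0 mul1r => /eqP.
  rewrite !mulf_eq0 (negbTE (Ga k Sk)) orbF expf_eq0 subr_eq0 [x == _]eq_sym.
  rewrite (negbTE akx) andbF orbF.
  by move=> /eqP.
rewrite hornerZ hornerM horner_prod (bigD1 k) /= ?k0 ?akx 1?(eq_sym k l) ?lk //.
by rewrite horner_exp hornerXsubC subrr expr0n muln_eq0 (gtn_eqF m0) mul0r !mulr0.
Qed.

(** * Polynomial numerators of solutions *)

Definition regular (K : numFieldType) (n : nat) (a : 'I_n.+1 -> K) (x : K) : Prop :=
  forall k, k != ord0 -> x != a k.

Definition poles (K : numFieldType) (n : nat) (a : 'I_n.+1 -> K) : seq K :=
  [seq a k | k <- enum (predC1 (@ord0 n))].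

Lemma regularP (K : numFieldType) (n : nat) (a : 'I_n.+1 -> K) (x : K) :
  regular a x <-> x \notin poles a.
Proof.
split=> [ax|ax k k0].
  apply/mapP => -[k]; rewrite mem_enum => k0 xk.
  by have := ax k k0; rewrite xk eqxx.
by apply: contraNneq ax => ->; apply: map_f; rewrite mem_enum.
Qed.

Lemma regular_exists (K : numFieldType) (n : nat) (a : 'I_n.+1 -> K) :
  exists x, regular a x.
Proof. by eexists; apply/regularP; apply: norm_sum_notin. Qed.

Definition denom (K : numFieldType) (n : nat) (a : 'I_n.+1 -> K) : {poly K} :=
  \prod_(k | k != ord0) ('X - (a k)%:P).

Definition pole_matrix (K : numFieldType) (n : nat) (a : 'I_n.+1 -> K) (x : K) :
    'M[K]_n.+1 :=
  \sum_(k | k != ord0) (x - a k)^-1 *: tperm_mx ord0 k.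

Definition sum_poles (K : numFieldType) (n : nat) (a : 'I_n.+1 -> K) (x : K) : K :=
  \sum_(k | k != ord0) (x - a k)^-1.

Definition evmx (K : numFieldType) (m n : nat) (x : K) (q : 'M[{poly K}]_(m, n)) :
    'M[K]_(m, n) := map_mx (horner_eval x) q.

Definition dmx (K : numFieldType) (m n : nat) (q : 'M[{poly K}]_(m, n)) :
  'M[{poly K}]_(m, n) := map_mx (@deriv K) q.

(* [q / denom a ^ m] solves the equation with [rho = r]. *)
Definition numerator_sol (K : numFieldType) (n : nat) (a : 'I_n.+1 -> K) (m : nat)
    (r : K) (q : 'M[{poly K}]_n.+1) : Prop :=
  forall x, regular a x ->
    evmx x (dmx q) = (m%:R * sum_poles a x) *: evmx x q +
                     r *: (pole_matrix a x *m evmx x q).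

Lemma denom_regular (K : numFieldType) (n : nat) (a : 'I_n.+1 -> K) (x : K) :
  regular a x -> (denom a).[x] != 0.
Proof.
move=> ax; rewrite horner_prod; apply/prodf_neq0 => k k0.
by rewrite hornerXsubC subr_eq0 ax.
Qed.

Lemma deriv_denom (K : numFieldType) (n : nat) (a : 'I_n.+1 -> K) (x : K) :
  regular a x -> (denom a)^`().[x] = (denom a).[x] * sum_poles a x.
Proof.
move=> ax; rewrite /denom /sum_poles.
apply: (big_rec2 (fun p s => p^`().[x] = p.[x] * s)).
  by rewrite derivC horner0 mulr0.
move=> k p s k0 h; rewrite derivM derivXsubC mul1r hornerD !hornerM hornerXsubC h.
have : x - a k != 0 by rewrite subr_eq0 ax.
by move=> xk; field.
Qed.

Lemma deriv_denomX (K : numFieldType) (n : nat) (a : 'I_n.+1 -> K) (x : K) (d : nat) :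
  regular a x ->
  (denom a ^+ d)^`().[x] = d%:R * sum_poles a x * (denom a ^+ d).[x].
Proof.
move=> ax; rewrite deriv_exp hornerMn hornerM deriv_denom // !horner_exp.
case: d => [|d]; first by rewrite mulr0n !mul0r.
by rewrite [in RHS]exprS -mulr_natr /=; ring.
Qed.

Lemma pole_matrixE (K : numFieldType) (n p : nat) (a : 'I_n.+1 -> K) (x : K)
    (B : 'M[K]_(n.+1, p)) i j :
  (pole_matrix a x *m B) i j =
  \sum_(k | k != ord0) (x - a k)^-1 * B (tperm ord0 k i) j.
Proof.
rewrite mulmx_suml summxE; apply: eq_bigr => k _.
by rewrite -scalemxAl -xrowE !mxE.
Qed.

Lemma pole_matrix0 (K : numFieldType) (n p : nat) (a : 'I_n.+1 -> K) (x : K)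
    (B : 'M[K]_(n.+1, p)) j :
  (pole_matrix a x *m B) ord0 j = \sum_(k | k != ord0) (x - a k)^-1 * B k j.
Proof. by rewrite pole_matrixE; apply: eq_bigr => k _; rewrite tpermL. Qed.

(** Only the transposition with [k = i] moves row [i]; the others contribute to the scalar
    [sum_poles], which the factor [prod_k (z_1 - z_k)^rho] accounts for. *)
Lemma pole_matrix_neq0 (K : numFieldType) (n p : nat) (a : 'I_n.+1 -> K) (x : K)
    (B : 'M[K]_(n.+1, p)) i j : i != ord0 ->
  (pole_matrix a x *m B) i j =
  (x - a i)^-1 * (B ord0 j - B i j) + sum_poles a x * B i j.
Proof.
move=> i0; rewrite pole_matrixE (bigD1 i) //= tpermR.
have -> : sum_poles a x = (x - a i)^-1 + \sum_(k | (k != ord0) && (k != i)) (x - a k)^-1.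
  exact: bigD1.
rewrite mulrDl mulr_suml addrA -mulrDr subrK; congr (_ + _).
by apply: eq_bigr => k /andP[_ ki]; rewrite tpermD // eq_sym.
Qed.

Lemma tr_pole_matrix (K : numFieldType) (n : nat) (a : 'I_n.+1 -> K) (x : K) :
  (pole_matrix a x)^T = pole_matrix a x.
Proof.
rewrite /pole_matrix linear_sum; apply: eq_bigr => k _.
by rewrite linearZ /= tr_tperm_mx.
Qed.

(** Here [u] is [q / denom^(2m)] and the solution is [denom^m u]. The rows other than [ord0] are the
    reduced system; row [ord0] follows by differentiating the constant sum of the [u_j]. *)
Lemma numerator_sol_intro (K : numFieldType) (n : nat) (a : 'I_n.+1 -> K) (m : nat)
    (q : 'M[{poly K}]_n.+1) :
  (forall k, cleared_ode a m (denom a ^+ (2 * m)) (fun j => q j k)) ->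
  (forall k, exists c : K, \sum_j q j k = c *: denom a ^+ (2 * m)) ->
  numerator_sol a m m%:R q.
Proof.
move=> ode sumq x ax; have Dx := denom_regular ax.
pose F := denom a ^+ (2 * m); have Fx : F.[x] != 0 by rewrite horner_exp expf_neq0.
pose L := sum_poles a x.
have F'x : F^`().[x] = 2 * m%:R * L * F.[x] by rewrite deriv_denomX // natrM.
have dq j k : j != ord0 -> (q j k)^`().[x] =
    2 * m%:R * L * (q j k).[x] + m%:R * (x - a j)^-1 * ((q ord0 k).[x] - (q j k).[x]).
  move=> j0; have xj : x - a j != 0 by rewrite subr_eq0 ax.
  have := congr1 (horner^~ x) (ode k j j0).
  rewrite hornerM hornerXsubC hornerMn hornerD hornerN !hornerM hornerD hornerN F'x => e.
  apply: (mulfI (mulf_neq0 xj Fx)).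
  rewrite -[RHS](subrK ((x - a j) * (2 * m%:R * L * F.[x] * (q j k).[x]))).
  apply/eqP; rewrite -subr_eq; apply/eqP; transitivity ((x - a j) *
     (F.[x] * (q j k)^`().[x] - 2 * m%:R * L * F.[x] * (q j k).[x])); first by ring.
  by rewrite e; field.
apply/matrixP => j k.
rewrite [LHS]mxE [dmx q j k]mxE [RHS]mxE [X in _ = X + _]mxE [X in _ = _ + X]mxE.
rewrite [evmx x q j k]mxE /horner_eval.
have [->|j0] := eqVneq j ord0; last first.
  by rewrite dq // pole_matrix_neq0 // !mxE /horner_eval -/L; ring.
rewrite pole_matrix0.
have [c sumk] := sumq k.
have s0 : (q ord0 k).[x] + \sum_(j | j != ord0) (q j k).[x] = c * F.[x].
  by rewrite -hornerZ -sumk horner_sum [RHS](bigD1 ord0).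
have s1 : (q ord0 k)^`().[x] + \sum_(j | j != ord0) (q j k)^`().[x] = c * F^`().[x].
  by rewrite -hornerZ -derivZ -sumk raddf_sum horner_sum [RHS](bigD1 ord0).
move: s1; under eq_bigr => i i0 do rewrite dq //.
rewrite big_split /= -mulr_sumr F'x => s1.
have -> : (q ord0 k)^`().[x] = 2 * m%:R * L * (q ord0 k).[x] -
   \sum_(i | i != ord0) m%:R / (x - a i) * ((q ord0 k).[x] - (q i k).[x]).
  apply/eqP; rewrite eq_sym subr_eq -subr_eq0; apply/eqP.
  transitivity (2 * m%:R * L * (c * F.[x]) - c * (2 * m%:R * L * F.[x])); last by ring.
  by rewrite -s1 -s0; ring.
have -> : \sum_(i | i != ord0) m%:R / (x - a i) * ((q ord0 k).[x] - (q i k).[x]) =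
    m%:R * L * (q ord0 k).[x] - m%:R * \sum_(i | i != ord0) (x - a i)^-1 * (q i k).[x].
  rewrite /L /sum_poles !mulr_sumr mulr_suml -sumrB; apply: eq_bigr => i _; ring.
under [X in _ = _ + _ * X]eq_bigr do rewrite mxE.
by rewrite /horner_eval -/L; ring.
Qed.

(** * Duality by inverse transposition *)

Lemma dmxM (K : numFieldType) (m n p : nat) (A : 'M[{poly K}]_(m, n))
    (B : 'M[{poly K}]_(n, p)) : dmx (A *m B) = dmx A *m B + A *m dmx B.
Proof.
apply/matrixP => i j; rewrite !mxE raddf_sum -big_split /=.
by apply: eq_bigr => k _; rewrite derivM !mxE.
Qed.

Lemma evmxM (K : numFieldType) (m n p : nat) (x : K) (A : 'M[{poly K}]_(m, n))
    (B : 'M[{poly K}]_(n, p)) : evmx x (A *m B) = evmx x A *m evmx x B.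
Proof. exact: map_mxM. Qed.

Lemma dual_evmx (K : numFieldType) (n : nat) (x : K) (D : {poly K})
    (q qv : 'M[{poly K}]_n.+1) :
  qv^T *m q = D%:M -> (evmx x qv)^T *m evmx x q = D.[x]%:M.
Proof.
move=> /(congr1 (evmx x)); rewrite evmxM /evmx map_trmx => ->.
exact: map_scalar_mx.
Qed.

Lemma dual_unitmx (K : numFieldType) (n : nat) (x : K) (D : {poly K})
    (q qv : 'M[{poly K}]_n.+1) :
  qv^T *m q = D%:M -> D.[x] != 0 -> evmx x q \in unitmx.
Proof.
move=> /(dual_evmx x) h Dx.
have /mulmx1_unit[] // : (D.[x]^-1 *: (evmx x qv)^T) *m evmx x q = 1%:M.
by rewrite -scalemxAl h scale_scalar_mx mulVf.
Qed.

(* As the matrices [P_(1,k)] are symmetric, inverse transposition turns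
   solutions for [r] into solutions for [- r]. *)
Lemma numerator_sol_dual (K : numFieldType) (n : nat) (a : 'I_n.+1 -> K) (m : nat)
    (r : K) (q qv : 'M[{poly K}]_n.+1) :
  numerator_sol a m r q -> qv^T *m q = (denom a ^+ (2 * m))%:M ->
  numerator_sol a m (- r) qv.
Proof.
move=> solq dual x ax.
pose F := denom a ^+ (2 * m).
have Fx : F.[x] != 0 by rewrite horner_exp expf_neq0 // denom_regular.
have qU := dual_unitmx dual Fx.
have ev := dual_evmx x dual.
(* This is the derivative of the duality relation. Once the equation for [q] is inserted, cancelling
   the invertible [evmx x q] gives the one for [qv]. *)
have e : (evmx x (dmx qv))^T *m evmx x q + (evmx x qv)^T *m evmx x (dmx q) =
    (2 * m%:R * sum_poles a x * F.[x])%:M.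
  have trE (A : 'M[{poly K}]_n.+1) : (evmx x A)^T = evmx x A^T by rewrite /evmx map_trmx.
  have -> : evmx x (dmx qv) = evmx x (dmx qv^T)^T by rewrite /dmx map_trmx trmxK.
  rewrite !trE trmxK -!evmxM -map_mxD -dmxM dual; apply/matrixP => i j; rewrite !mxE /=.
  by rewrite derivMn /horner_eval hornerMn deriv_denomX // natrM.
rewrite solq // mulmxDr -!scalemxAr ev in e.
apply: trmx_inj; apply: (can_inj (mulmxK qU)).
rewrite linearD !linearZ /= trmx_mul tr_pole_matrix mulmxDl -!scalemxAl.
rewrite -mulmxA ev.
apply/eqP; rewrite -subr_eq0; apply/eqP.
transitivity ((2 * m%:R * sum_poles a x * F.[x])%:M -
  2 *: ((m%:R * sum_poles a x) *: F.[x]%:M) : 'M[K]_n.+1); last first.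
  by rewrite !scale_scalar_mx -raddfB /= !mulrA subrr raddf0.
rewrite -e scaler_nat mulr2n scaleNr.
set T1 := _ *m evmx x q; set T2 := _ *: _%:M; set T3 := r *: _.
by rewrite !opprD opprK !addrA (addrAC (T1 + T2)) addrK [RHS]addrAC.
Qed.

Lemma poly_eq0_horner (K : numFieldType) (p : {poly K}) :
  (forall x, p.[x] = 0) -> p = 0.
Proof.
move=> p0; apply: (@roots_geq_poly_eq0 _ _ [seq i%:R | i <- iota 0 (size p)]).
- by apply/allP => x _; rewrite /root p0.
- rewrite map_inj_uniq ?iota_uniq // => i j /eqP.
  by rewrite eqr_nat => /eqP.
- by rewrite size_map size_iota.
Qed.

(** Multiplication by [denom a] makes the difference vanish at the excluded points as well. *)
Lemma poly_eq_regular (K : numFieldType) (n : nat) (a : 'I_n.+1 -> K) (p q : {poly K}) :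
  (forall x, regular a x -> p.[x] = q.[x]) -> p = q.
Proof.
move=> pq; apply/eqP; rewrite -subr_eq0.
have D0 : denom a != 0 by apply/prodf_neq0 => k _; rewrite polyXsubC_eq0.
rewrite -(mulrI_eq0 _ (mulfI D0)); apply/eqP; apply: poly_eq0_horner => x.
rewrite hornerM hornerD hornerN.
have [/existsP[k /andP[k0 /eqP ->]]|nreg] := boolP [exists k, (k != ord0) && (x == a k)].
  by rewrite horner_prod (bigD1 k) //= hornerXsubC subrr !mul0r.
rewrite pq ?subrr ?mulr0 // => k k0; apply: contra nreg => /eqP ->.
by apply/existsP; exists k; rewrite k0 eqxx.
Qed.

Lemma size_denom (K : numFieldType) (n : nat) (a : 'I_n.+1 -> K) :
  size (denom a) = n.+1.
Proof.
rewrite /denom big_mkcond big_ord_recl /= mul1r.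
by rewrite size_prod_XsubC /index_enum -enumT size_enum_ord.
Qed.

Lemma monic_denom (K : numFieldType) (n : nat) (a : 'I_n.+1 -> K) : denom a \is monic.
Proof. exact: monic_prod_XsubC. Qed.

Lemma size_exp_monic (K : fieldType) (p : {poly K}) (d : nat) :
  p \is monic -> size (p ^+ d) = ((size p).-1 * d).+1.
Proof.
move=> pm; rewrite -size_exp prednK // lt0n size_poly_eq0.
by rewrite monic_neq0 // monic_exp.
Qed.

Definition max_degree (K : numFieldType) (n : nat) (q : 'M[{poly K}]_n.+1) (d : nat) : Prop :=
  (forall i j, (size (q i j) <= d.+1)%N) /\ exists i j, size (q i j) = d.+1.

(** Over an algebraically closed field a determinant without roots is a nonzero constant, so
    invertibility at every point is enough. *)
Lemma pole_mx_unit (K : numClosedFieldType) (n : nat) (a : 'I_n.+1 -> K) (m : nat)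
    (M : 'M[{poly K}]_n.+1) :
  {in predC1 ord0 &, injective a} -> (0 < m)%N -> pole_mx a m M -> M \in unitmx.
Proof.
move=> ainj m0 hM.
have detM x : (\det M).[x] != 0.
  rewrite -[_.[x]]/(horner_eval x (\det M)) -det_map_mx -det_tr.
  apply/negP => /det0P[c c0 /matrixP Mc].
  case/negP: c0; apply/eqP/rowP => k; rewrite [RHS]mxE.
  apply: (pole_mx_inj (c := fun k => c ord0 k) ainj m0 hM (x := x)) => j.
  have := Mc ord0 j; rewrite [RHS]mxE; apply: etrans; rewrite mxE.
  by apply: eq_bigr => l _; rewrite !mxE.
have /eqP s1 : size (\det M) == 1.
  apply: contraT => /closed_rootP[x /rootP/eqP].
  by rewrite (negbTE (detM x)).
rewrite unitmxE poly_unitE s1 eqxx unitfE -horner_coef0; exact: detM.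
Qed.

(** * Numerators for the two signs of [rho], and their degrees *)

Definition cofactor_denom (K : numFieldType) (n : nat) (a : 'I_n.+1 -> K)
    (k : 'I_n.+1) : {poly K} :=
  \prod_(l | (l != ord0) && (l != k)) ('X - (a l)%:P).

Lemma denom_cofactor (K : numFieldType) (n : nat) (a : 'I_n.+1 -> K) (k : 'I_n.+1) :
  k != ord0 -> denom a = ('X - (a k)%:P) * cofactor_denom a k.
Proof. by move=> k0; rewrite /denom (bigD1 k). Qed.

Lemma size_cofactor_denom (K : numFieldType) (n : nat) (a : 'I_n.+1 -> K) (k : 'I_n.+1) :
  k != ord0 -> size (cofactor_denom a k) = n.
Proof.
move=> k0; have := size_denom a.
rewrite (denom_cofactor _ k0) mulrC size_Mmonic ?monicXsubC //.
  by rewrite size_XsubC addn2 => -[].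
by apply/prodf_neq0 => l _; rewrite polyXsubC_eq0.
Qed.

(** The basis solutions [u], all brought over the denominator [denom a ^+ (2 * m)]. *)
Definition pos_numerator (K : numFieldType) (n : nat) (a : 'I_n.+1 -> K) (m : nat)
    (M : 'M[{poly K}]_n.+1) : 'M[{poly K}]_n.+1 :=
  \matrix_(j, k) (M j k * (if k == ord0 then denom a else cofactor_denom a k) ^+ (2 * m)).

(** For invertible [M] this is [denom a ^+ (2 * m)] times the inverse transpose of [pos_numerator],
    in a form that is visibly polynomial. *)
Definition neg_numerator (K : numFieldType) (n : nat) (a : 'I_n.+1 -> K) (m : nat)
    (M : 'M[{poly K}]_n.+1) : 'M[{poly K}]_n.+1 :=
  \matrix_(j, k) (invmx M k j * (if k == ord0 then 1 else 'X - (a k)%:P) ^+ (2 * m)).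

Lemma pos_neg_numerator (K : numFieldType) (n : nat) (a : 'I_n.+1 -> K) (m : nat)
    (M : 'M[{poly K}]_n.+1) : M \in unitmx ->
  (neg_numerator a m M)^T *m pos_numerator a m M = (denom a ^+ (2 * m))%:M.
Proof.
move=> Mu; apply/matrixP => i k; rewrite !mxE.
transitivity ((\sum_j invmx M i j * M j k) *
   ((if i == ord0 then 1 else 'X - (a i)%:P) ^+ (2 * m) *
    (if k == ord0 then denom a else cofactor_denom a k) ^+ (2 * m))).
  rewrite mulr_suml; apply: eq_bigr => j _; rewrite !mxE; ring.
have := mulVmx Mu => /matrixP/(_ i k); rewrite !mxE => ->.
have [->|ik] := eqVneq i k; last by rewrite mulr0n mul0r mulr0n.
rewrite mulr1n mul1r mulr1n -exprMn; congr (_ ^+ _).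
have [_|k0] := eqVneq k ord0; first by rewrite mul1r.
by rewrite -denom_cofactor.
Qed.

Lemma pos_numerator_sol (K : numFieldType) (n : nat) (a : 'I_n.+1 -> K) (m : nat)
    (M : 'M[{poly K}]_n.+1) : (0 < m)%N -> pole_mx a m M ->
  numerator_sol a m m%:R (pos_numerator a m M).
Proof.
move=> m0 hM; have [M1 _ _ sumM _] := hM.
apply: numerator_sol_intro => k.
  have [->|k0] := eqVneq k ord0.
    by move=> j j0; rewrite !mxE !eqxx !M1 !mul1r; apply: cleared_ode_cst.
  have := pole_mx_cleared_ode (cofactor_denom a k ^+ (2 * m)) hM m0 k0.
  rewrite -exprMn -denom_cofactor // => h j j0.
  by rewrite !mxE (negbTE k0); apply: h.
have [->|k0] := eqVneq k ord0.
  exists n.+1%:R; under eq_bigr do rewrite mxE eqxx M1 mul1r.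
  by rewrite sumr_const card_ord scaler_nat.
exists 0; under eq_bigr do rewrite mxE.
by rewrite -mulr_suml sumM // mul0r scale0r.
Qed.

(** The column of ones has exactly this degree; the other columns have degree at most
    [m + 2m (n - 1)]. *)
Lemma pos_numerator_size (K : numFieldType) (n : nat) (a : 'I_n.+1 -> K) (m : nat)
    (M : 'M[{poly K}]_n.+1) : (0 < m)%N -> pole_mx a m M ->
  max_degree (pos_numerator a m M) (2 * m * n).
Proof.
move=> m0 [M1 sizeM _ _ _].
have sD : size (denom a ^+ (2 * m)) = (2 * m * n).+1.
  by rewrite size_exp_monic ?monic_denom // size_denom mulnC.
split=> [j k|]; last by exists ord0, ord0; rewrite mxE eqxx M1 mul1r sD.
rewrite mxE; have [->|k0] := eqVneq k ord0; first by rewrite M1 mul1r sD.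
have mon : cofactor_denom a k \is monic by apply: monic_prod_XsubC.
rewrite (leq_trans (size_mul_leq _ _)) // size_exp_monic // size_cofactor_denom // addnS /=.
have := sizeM j k k0; case: n a k k0 {M1 sizeM mon sD} M j => [|n] a k k0 M j.
  by case: k k0 => [[]].
rewrite /=; nia.
Qed.

(* The growth rates at infinity are the exponents [0], [m] and [m * n.+1]. *)
Lemma neg_degree_step (K : numFieldType) (n : nat) (a : 'I_n.+1 -> K) (m d : nat)
    (p : 'I_n.+1 -> {poly K}) :
  (forall j, j != ord0 -> ('X - (a j)%:P) * (p j)^`() = - (p ord0 - p j) *+ m) ->
  \sum_j (p j)^`() = 0 -> (0 < d)%N -> d != m -> d != (m * n.+1)%N ->
  (forall j, (size (p j) <= d.+1)%N) -> forall j, (size (p j) <= d)%N.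
Proof.
move=> ode sump d0 dm dN sp.
have dK : d%:R != 0 :> K by rewrite pnatr_eq0 -lt0n.
have cj j : j != ord0 -> (d%:R - m%:R) * (p j)`_d = - m%:R * (p ord0)`_d.
  move=> j0; have := congr1 (fun q : {poly K} => q`_d) (ode j j0).
  rewrite mulrBl coefB coefXM gtn_eqF // coefCM !coef_deriv prednK //.
  rewrite [(p j)`_d.+1]nth_default // mul0rn mulr0 subr0 coefMn coefN coefB => e.
  by rewrite [LHS]mulrBl !mulr_natl e; ring.
have s0 : \sum_j (p j)`_d = 0.
  have := congr1 (fun q : {poly K} => q`_d.-1) sump.
  rewrite coef_sum coef0; under eq_bigr do rewrite coef_deriv prednK // -mulr_natl.
  by rewrite -mulr_sumr => /eqP; rewrite mulf_eq0 (negbTE dK) => /eqP.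
have c0 : (p ord0)`_d = 0.
  (* Summing the relations [cj] and using [s0] eliminates every coefficient but that of [p ord0]. *)
  have : (d%:R - (m * n.+1)%:R) * (p ord0)`_d = 0.
    transitivity ((d%:R - m%:R) * \sum_j (p j)`_d); last by rewrite s0 mulr0.
    rewrite (bigD1 ord0) //= mulrDr mulr_sumr (eq_bigr (fun=> - m%:R * (p ord0)`_d)) //.
    rewrite big_mkcond big_ord_recl /= add0r sumr_const card_ord.
    by rewrite mulnS natrD natrM -mulr_natl; ring.
  by move/eqP; rewrite mulf_eq0 subr_eq0 eqr_nat (negbTE dN) => /eqP.
move=> j; have cjd : (p j)`_d = 0.
  have [->//|j0] := eqVneq j ord0.
  have /eqP := cj j j0; rewrite c0 mulr0 mulf_eq0 subr_eq0 eqr_nat (negbTE dm).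
  by move=> /eqP.
apply/leq_sizeP => i; rewrite leq_eqVlt => /predU1P[<- //|di].
by apply: nth_default; apply: leq_trans di.
Qed.

Lemma neg_degree_descent (K : numFieldType) (n : nat) (a : 'I_n.+1 -> K) (m lo e : nat)
    (p : 'I_n.+1 -> {poly K}) :
  (forall j, j != ord0 -> ('X - (a j)%:P) * (p j)^`() = - (p ord0 - p j) *+ m) ->
  \sum_j (p j)^`() = 0 ->
  (forall d, (lo < d <= lo + e)%N -> d != m /\ d != (m * n.+1)%N) ->
  (forall j, (size (p j) <= (lo + e).+1)%N) -> forall j, (size (p j) <= lo.+1)%N.
Proof.
move=> ode sump; elim: e => [|e ih] res sp; first by rewrite addn0 in sp.
apply: ih => [d /andP[d1 d2]|j]; first by apply: res; lia.
have [] := res (lo + e.+1)%N; first lia.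
rewrite -addnS => r1 r2; apply: (neg_degree_step ode sump) => //; lia.
Qed.

(** For the sign [- m] the term [m * sum_poles] cancels the scalar part of [pole_matrix], so the
    columns of [q] themselves satisfy the system for [u]. *)
Lemma neg_sol_columns (K : numFieldType) (n : nat) (a : 'I_n.+1 -> K) (m : nat)
    (q : 'M[{poly K}]_n.+1) (k : 'I_n.+1) :
  numerator_sol a m (- m%:R) q ->
  (forall j, j != ord0 ->
    ('X - (a j)%:P) * (q j k)^`() = - (q ord0 k - q j k) *+ m) /\
  \sum_j (q j k)^`() = 0.
Proof.
move=> solq.
have dq x j : regular a x -> j != ord0 -> (q j k)^`().[x] =
    - m%:R * (x - a j)^-1 * ((q ord0 k).[x] - (q j k).[x]).
  move=> ax j0; have /matrixP/(_ j k) := solq x ax.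
  rewrite [LHS]mxE [dmx q j k]mxE [RHS]mxE [X in _ = X + _]mxE [X in _ = _ + X]mxE.
  by rewrite pole_matrix_neq0 // !mxE /horner_eval => ->; ring.
split=> [j j0|]; apply: (poly_eq_regular (a := a)) => x ax.
  have xj : x - a j != 0 by rewrite subr_eq0 ax.
  rewrite hornerM hornerXsubC dq // hornerMn hornerN hornerD hornerN -mulr_natl.
  by field.
rewrite horner0 horner_sum (bigD1 ord0) //=.
have /matrixP/(_ ord0 k) := solq x ax.
rewrite [LHS]mxE [dmx q _ k]mxE [RHS]mxE [X in _ = X + _]mxE [X in _ = _ + X]mxE.
rewrite pole_matrix0 [evmx x q ord0 k]mxE /horner_eval => ->.
under eq_bigr => j j0 do rewrite dq //.
under [X in _ + _ * X + _]eq_bigr => j j0 do rewrite mxE /horner_eval.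
rewrite /sum_poles !mulr_sumr mulr_suml -!big_split /= big1 // => j _; ring.
Qed.

(** No exponent exceeds [m (n + 1)], which bounds the degree. Were the bound not attained, column
    [k] would drop to degree [m]; being divisible by [(X - a_k)^(2m)] it would vanish, against the
    duality. *)
Lemma neg_numerator_size (K : numFieldType) (n : nat) (a : 'I_n.+1 -> K) (m : nat)
    (q qv : 'M[{poly K}]_n.+1) :
  (0 < n)%N -> (0 < m)%N -> numerator_sol a m (- m%:R) q ->
  q^T *m qv = (denom a ^+ (2 * m))%:M ->
  (forall j k, k != ord0 -> ('X - (a k)%:P) ^+ (2 * m) %| q j k) ->
  max_degree q (m * n.+1).
Proof.
move=> n0 m0 solq dual dvd.
have le k : forall j, (size (q j k) <= (m * n.+1).+1)%N.
  have [ode sumq] := neg_sol_columns k solq.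
  (* The sum of the sizes lets the descent start above every entry of the column. *)
  apply: (neg_degree_descent (e := \sum_j size (q j k)) ode sumq) => [d|j]; first by nia.
  by rewrite (bigD1 j) //=; lia.
split=> [j k|]; first exact: le.
case: (boolP [exists j, exists k, size (q j k) == (m * n.+1).+1]).
  by move=> /existsP[j /existsP[k /eqP e]]; exists j, k.
rewrite negb_exists => /forallP small; exfalso.
pose k : 'I_n.+1 := lift ord0 (Ordinal n0).
have k0 : k != ord0 by rewrite eq_sym neq_lift.
have lt j : (size (q j k) <= m * n.+1)%N.
  have := small j; rewrite negb_exists => /forallP/(_ k).
  by have := le k j; rewrite leq_eqVlt => /orP[->//|]; rewrite ltnS.
have lem j : (size (q j k) <= m.+1)%N.
  have [ode sumq] := neg_sol_columns k solq.
  (* As [m + (m n - 1)] is one less than [m (n + 1)], the descent to [m] meets no exponent. *)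
  apply: (neg_degree_descent (e := m * n - 1) ode sumq) => [d|i].
    by move=> /andP[? ?]; split; apply/eqP; nia.
  by apply: leq_trans (lt i) _; nia.
have q0 j : q j k = 0.
  apply/eqP; apply: contraT => qjk; have := dvdp_leq qjk (dvd j k k0).
  by rewrite size_exp_XsubC => /leq_trans/(_ (lem j)); lia.
have /matrixP/(_ k k) := dual; rewrite !mxE eqxx mulr1n big1 => [/esym/eqP|j _].
  by rewrite expf_eq0 (negbTE (monic_neq0 (monic_denom a))) andbF.
by rewrite mxE q0 mul0r.
Qed.

Lemma numerators_exist (K : numClosedFieldType) (n : nat) (a : 'I_n.+1 -> K) (m : nat) :
  {in predC1 ord0 &, injective a} -> (0 < n)%N ->
  exists q qv : 'M[{poly K}]_n.+1,
  [/\ numerator_sol a m m%:R q, numerator_sol a m (- m%:R) qv,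
      qv^T *m q = (denom a ^+ (2 * m))%:M,
      (0 < m)%N -> max_degree q (2 * m * n) &
      (0 < m)%N -> max_degree qv (m * n.+1)].
Proof.
move=> ainj n0; have [->|m0] := posnP m.
  (* For [m = 0] the equation is [q' = 0]. *)
  exists 1%:M, 1%:M; split => //; last by rewrite trmx1 mul1mx muln0 expr0.
    move=> x _; rewrite mul0r !scale0r addr0.
    by apply/matrixP => i j; rewrite !mxE derivMn derivC mul0rn /horner_eval horner0.
  move=> x _; rewrite mul0r oppr0 !scale0r addr0.
  by apply/matrixP => i j; rewrite !mxE derivMn derivC mul0rn /horner_eval horner0.
have [M hM] := pole_mx_exists ainj m0.
have Mu := pole_mx_unit ainj m0 hM.
have sol := pos_numerator_sol m0 hM.
have dual := pos_neg_numerator a m Mu.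
exists (pos_numerator a m M), (neg_numerator a m M); split => //.
- exact: (numerator_sol_dual sol dual).
- by move=> _; apply: pos_numerator_size.
- move=> _; apply: (neg_numerator_size (qv := pos_numerator a m M)) => //.
  + exact: (numerator_sol_dual sol dual).
  + exact: dual.
  + by move=> j k k0; rewrite mxE (negbTE k0) dvdp_mulIr.
Qed.

(** For [rho < 0] the two numerators change places. The degrees are split as [m n] plus a remainder
    because dividing by [denom^m] will remove [m n]. *)
Lemma numerator_rho (K : numClosedFieldType) (n : nat) (a : 'I_n.+1 -> K) (rho : int) :
  {in predC1 ord0 &, injective a} -> (0 < n)%N ->
  exists q qv : 'M[{poly K}]_n.+1,
  [/\ numerator_sol a `|rho| rho%:~R q, numerator_sol a `|rho| (- rho%:~R) qv,
      qv^T *m q = (denom a ^+ (2 * `|rho|))%:M,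
      0 < rho -> max_degree q (`|rho| * n + `|rho| * n) &
      rho < 0 -> max_degree q (`|rho| * n + `|rho|)].
Proof.
move=> ainj n0; have [q [qv [sol solv dual sz szv]]] := numerators_exist `|rho| ainj n0.
have [rho0|rho0] := leP 0 rho.
  exists q, qv; rewrite -[rho in rho%:~R]gez0_abs //; split => //.
  by move=> rho1; have := sz _; rewrite absz_gt0 gt_eqF // -mulnA mul2n -addnn; apply.
have -> : rho%:~R = - `|rho|%:R :> K by rewrite -[in LHS](opprK rho) -(ltz0_abs rho0) mulrNz.
exists qv, q; rewrite opprK; split => //.
- by apply: trmx_inj; rewrite trmx_mul trmxK dual tr_scalar_mx.
- by move=> rho1; have := lt_trans rho0 rho1; rewrite ltxx.
- by move=> _; have := szv _; rewrite absz_gt0 lt_eqF // mulnS addnC; apply.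
Qed.

(** * Partial fractions *)

Lemma partial_fraction1 (K : fieldType) (b : K) (m : nat) (p : {poly K}) :
  exists (c : nat -> K) (Q : {poly K}), forall x, x != b ->
    p.[x] / (x - b) ^+ m = \sum_(1 <= j < m.+1) (x - b) ^- j * c j + Q.[x].
Proof.
elim: m p => [|m ih] p.
  by exists (fun=> 0), p => x _; rewrite big_geq // add0r expr0 divr1.
have /factor_theorem[q qE] : root (p - p.[b]%:P) b.
  by rewrite /root hornerD hornerN hornerC subrr.
have [c [Q cQ]] := ih q.
exists (fun j => if j == m.+1 then p.[b] else c j), Q => x xb.
have xb0 : x - b != 0 by rewrite subr_eq0.
rewrite big_nat_recr //= eqxx addrAC.
rewrite (_ : \sum_(1 <= j < m.+1) _ = \sum_(1 <= j < m.+1) (x - b) ^- j * c j); last first.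
  by apply: eq_big_nat => j /andP[_ jm]; rewrite ltn_eqF.
rewrite -cQ // -[in LHS](subrK p.[b]%:P p) qE hornerD hornerM hornerXsubC hornerC exprS.
by field; rewrite expf_neq0 // xb0.
Qed.

(** A Bezout relation between [(X - b)^m] and the product of the other factors separates the pole
    [b] from the rest. *)
Lemma partial_fraction_seq (K : fieldType) (s : seq K) (m : nat) (p : {poly K}) :
  uniq s ->
  exists (c : K -> nat -> K) (Q : {poly K}), forall x, x \notin s ->
    p.[x] / \prod_(b <- s) (x - b) ^+ m =
    \sum_(b <- s) \sum_(1 <= j < m.+1) (x - b) ^- j * c b j + Q.[x].
Proof.
elim: s p => [|b s ih] p /=.
  by move=> _; exists (fun _ _ => 0), p => x _; rewrite !big_nil add0r divr1.
move=> /andP[bs us].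
pose E := \prod_(y <- s) ('X - y%:P) ^+ m.
have Ex x : E.[x] = \prod_(y <- s) (x - y) ^+ m.
  by rewrite horner_prod; apply: eq_bigr => y _; rewrite horner_exp hornerXsubC.
have E0 x : x \notin s -> \prod_(y <- s) (x - y) ^+ m != 0.
  move=> xs; rewrite prodf_seq_neq0; apply/allP => y ys /=.
  by rewrite expf_neq0 // subr_eq0; apply: contraNneq xs => ->.
have /Bezout_eq1_coprimepP[[u v] /= uv] : coprimep E (('X - b%:P) ^+ m).
  by rewrite coprimep_expr // coprimep_XsubC /root Ex E0.
have [c1 [Q1 h1]] := partial_fraction1 b m (p * u).
have [c2 [Q2 h2]] := ih (p * v) us.
exists (fun y => if y == b then c1 else c2 y), (Q1 + Q2) => x.
rewrite inE negb_or => /andP[xb xs]; rewrite !big_cons eqxx hornerD.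
rewrite [X in _ = _ + X + _](_ : _ =
    \sum_(y <- s) \sum_(1 <= j < m.+1) (x - y) ^- j * c2 y j); last first.
  by apply: eq_big_seq => y ys; case: eqVneq ys => [->|//]; rewrite (negbTE bs).
rewrite addrACA -h1 // -h2 // !hornerM.
have /(congr1 (horner^~ x)) := uv.
rewrite hornerD !hornerM Ex horner_exp hornerXsubC hornerC => e.
have := E0 x xs; set G := \prod_(y <- s) _ in e *; move=> G0.
have xb0 : (x - b) ^+ m != 0 by rewrite expf_neq0 // subr_eq0.
rewrite -[p.[x] in LHS]mulr1 -e; field.
by rewrite G0 xb0.
Qed.

(** Identifying the polynomial part with the Euclidean quotient gives access to its degree. *)
Lemma partial_fraction_denom (K : numFieldType) (n : nat) (a : 'I_n.+1 -> K) (m : nat)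
    (p : {poly K}) : {in predC1 ord0 &, injective a} ->
  exists c : 'I_n.+1 -> nat -> K, forall x, regular a x ->
    p.[x] / (denom a).[x] ^+ m =
    \sum_(k | k != ord0) \sum_(1 <= j < m.+1) (x - a k) ^- j * c k j +
    (p %/ denom a ^+ m).[x].
Proof.
move=> ainj; pose s := poles a.
have us : uniq s.
  rewrite map_inj_in_uniq ?enum_uniq // => i j; rewrite !mem_enum; exact: ainj.
have [c [Q cQ]] := partial_fraction_seq m p us.
have bigs (T : Type) (idx : T) (op : Monoid.com_law idx) (F : K -> T) :
    \big[op/idx]_(b <- s) F b = \big[op/idx]_(k | k != ord0) F (a k).
  by rewrite big_map big_enum.
(* [T] is the polar part multiplied by [denom a ^+ m]; being of smaller size than this divisor, it
   is the remainder. *)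
pose T := \sum_(k | k != ord0) \sum_(1 <= j < m.+1)
   c (a k) j *: (cofactor_denom a k ^+ m * ('X - (a k)%:P) ^+ (m - j)).
have Tx x : regular a x -> T.[x] = (denom a).[x] ^+ m *
    \sum_(k | k != ord0) \sum_(1 <= j < m.+1) (x - a k) ^- j * c (a k) j.
  move=> ax; rewrite /T horner_sum mulr_sumr; apply: eq_bigr => k k0.
  rewrite horner_sum mulr_sumr; apply: eq_big_nat => j /andP[_ jm].
  rewrite (denom_cofactor _ k0) hornerZ !hornerM !horner_exp hornerXsubC.
  have xk : x - a k != 0 by rewrite subr_eq0 ax.
  have -> : ((x - a k) * (cofactor_denom a k).[x]) ^+ m =
      (x - a k) ^+ (m - j) * (x - a k) ^+ j * (cofactor_denom a k).[x] ^+ m.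
    by rewrite exprMn -exprD subnK.
  by field; rewrite expf_neq0.
have Dx x : regular a x -> (denom a).[x] ^+ m != 0.
  by move=> ax; rewrite expf_neq0 // denom_regular.
have prodE x : \prod_(b <- s) (x - b) ^+ m = (denom a).[x] ^+ m.
  rewrite bigs horner_prod -prodrXl; apply: eq_bigr => k _.
  by rewrite hornerXsubC.
have pE : p = Q * denom a ^+ m + T.
  apply: (poly_eq_regular (a := a)) => x ax.
  have := cQ x ((regularP a x).1 ax); rewrite prodE bigs => /(canRL (divfK (Dx x ax))) ->.
  by rewrite hornerD hornerM horner_exp Tx //; ring.
have sT : (size T < size (denom a ^+ m))%N.
  rewrite size_exp_monic ?monic_denom // size_denom ltnS.
  apply: (leq_trans (size_sum _ _ _)); apply/bigmax_leqP => k k0.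
  rewrite big_nat; apply: (leq_trans (size_sum _ _ _)).
  apply/bigmax_leqP_seq => j _ /andP[j1 jm].
  apply: leq_trans (size_scale_leq _ _) _; apply: leq_trans (size_mul_leq _ _) _.
  have mon : cofactor_denom a k \is monic by apply: monic_prod_XsubC.
  rewrite size_exp_monic // size_cofactor_denom // size_exp_XsubC.
  case: n a k k0 {ainj s us cQ bigs T Tx Dx prodE pE mon} => [|n] a k k0.
    by case: k k0 => [[]].
  by rewrite /=; nia.
exists (fun k => c (a k)) => x ax.
have -> : p %/ denom a ^+ m = Q by rewrite pE divp_addl_mul_small.
by rewrite -prodE cQ ?bigs //; apply/regularP.
Qed.

(** * Matrices of polynomials as polynomials with matrix coefficients *)

Definition polymx (K : numFieldType) (n d : nat) (q : 'M[{poly K}]_n.+1) :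
    {poly 'M[K]_n.+1} :=
  \poly_(e < d.+1) \matrix_(i, j) (q i j)`_e.

Lemma horner_polymx (K : numFieldType) (n d : nat) (q : 'M[{poly K}]_n.+1) (x : K) :
  (forall i j, (size (q i j) <= d.+1)%N) -> (polymx d q).[x%:M] = evmx x q.
Proof.
move=> sq; rewrite horner_poly; apply/matrixP => i j.
rewrite summxE !mxE /horner_eval (horner_coef_wide _ (sq i j)).
apply: eq_bigr => e _; have -> : x%:M ^+ e = (x ^+ e)%:M :> 'M[K]_n.+1.
  by rewrite -rmorphXn.
by rewrite -[_ * _]/(_ *m _) mul_mx_scalar !mxE mulrC.
Qed.

Lemma size_polymx (K : numFieldType) (n d : nat) (q : 'M[{poly K}]_n.+1) :
  max_degree q d -> size (polymx d q) = d.+1.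
Proof.
move=> [_ [i [j sq]]]; rewrite size_poly_eq //; apply/eqP => /matrixP/(_ i j).
rewrite !mxE => e; have : lead_coef (q i j) = 0 by rewrite lead_coefE sq.
by move=> /eqP; rewrite lead_coef_eq0 -size_poly_eq0 sq.
Qed.

(** The coefficient matrix of degree [d] is multiplied by an invertible matrix, so it stays
    nonzero. *)
Lemma max_degree_mulr (K : numFieldType) (n d : nat) (q : 'M[{poly K}]_n.+1)
    (C : 'M[K]_n.+1) : C \in unitmx -> max_degree q d ->
  max_degree (q *m map_mx polyC C) d.
Proof.
move=> Cu [sq [i0 [j0 sq0]]].
have coefE i j e : ((q *m map_mx polyC C) i j)`_e = ((\matrix_(i, j) (q i j)`_e) *m C) i j.
  rewrite !mxE coef_sum; apply: eq_bigr => k _.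
  by rewrite !mxE coefMC.
have le i j : (size ((q *m map_mx polyC C) i j) <= d.+1)%N.
  apply/leq_sizeP => e de; rewrite coefE mxE big1 // => k _.
  by rewrite mxE nth_default ?mul0r // (leq_trans (sq i k)).
split=> //.
case: (boolP [exists i, exists j, size ((q *m map_mx polyC C) i j) == d.+1]).
  by move=> /existsP[i /existsP[j /eqP h]]; exists i, j.
rewrite negb_exists => /forallP small; exfalso.
suff /matrixP/(_ i0 j0) : (\matrix_(i, j) (q i j)`_d) = 0.
  rewrite !mxE => e; have : lead_coef (q i0 j0) = 0 by rewrite lead_coefE sq0.
  by move=> /eqP; rewrite lead_coef_eq0 -size_poly_eq0 sq0.
apply: (can_inj (mulmxK Cu)); rewrite mul0mx; apply/matrixP => i j.
rewrite -coefE [RHS]mxE; apply: nth_default.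
have := small i; rewrite negb_exists => /forallP/(_ j).
by have := le i j; rewrite leq_eqVlt => /orP[->//|]; rewrite ltnS.
Qed.

Lemma max_degree_divp (K : numFieldType) (n m d : nat) (a : 'I_n.+1 -> K)
    (q : 'M[{poly K}]_n.+1) : max_degree q (m * n + d) ->
  max_degree (map_mx (fun p => p %/ denom a ^+ m) q) d.
Proof.
have D0 : denom a ^+ m != 0 by rewrite monic_neq0 // monic_exp // monic_denom.
have sD : (size (denom a ^+ m)).-1 = (m * n)%N.
  by rewrite size_exp_monic ?monic_denom // size_denom mulnC.
move=> [sq [i [j sqij]]]; split=> [k l|].
  by rewrite mxE size_divp // sD leq_subLR addnS.
by exists i, j; rewrite mxE size_divp // sD sqij -addnS addKn.
Qed.

(** * Solutions in the variable z_1 *)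

(** The parameters are reindexed to match the coordinates of [z]; the value 0 at [ord0] is a filler,
    whence the injectivity on [predC1 ord0] only. *)
Definition node (R : realType) (n : nat) (xi : 'rV[R[i]]_n) (k : 'I_n.+1) : R[i] :=
  oapp (xi ord0) 0 (unlift ord0 k).

Definition with_first (R : realType) (n : nat) (xi : 'rV[R[i]]_n) (x : R[i]) :
    'rV[R[i]]_n.+1 :=
  \row_j oapp (xi ord0) x (unlift ord0 j).

Lemma node_xi_of (R : realType) (n : nat) (z : 'rV[R[i]]_n.+1) (k : 'I_n.+1) :
  k != ord0 -> node (xi_of z) k = z ord0 k.
Proof.
rewrite /node; case: unliftP => [j -> _|->]; last by rewrite eqxx.
by rewrite /= mxE.
Qed.

Lemma with_first_xi_of (R : realType) (n : nat) (z : 'rV[R[i]]_n.+1) :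
  with_first (xi_of z) (z ord0 ord0) = z.
Proof. by apply/rowP => k; rewrite mxE; case: unliftP => [j|] ->; rewrite //= mxE. Qed.

Lemma xi_of_with_first (R : realType) (n : nat) (xi : 'rV[R[i]]_n) (x : R[i]) :
  xi_of (with_first xi x) = xi.
Proof. by apply/rowP => k; rewrite !mxE liftK. Qed.

Lemma with_first0 (R : realType) (n : nat) (xi : 'rV[R[i]]_n) (x : R[i]) :
  with_first xi x ord0 ord0 = x.
Proof. by rewrite mxE unlift_none. Qed.

Lemma A1_pole_matrix (R : realType) (n : nat) (z : 'rV[R[i]]_n.+1) :
  A1 z = pole_matrix (node (xi_of z)) (z ord0 ord0).
Proof. by apply: eq_bigr => k k0; rewrite node_xi_of. Qed.

Lemma node_inj (R : realType) (n : nat) (xi : 'rV[R[i]]_n) :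
  distinct_coords xi -> {in predC1 ord0 &, injective (node xi)}.
Proof.
move=> dxi j k; rewrite !inE /node.
by case: unliftP => [j' ->|->]; case: unliftP => [k' ->|->]; rewrite ?eqxx //= => _ _ /dxi ->.
Qed.

Lemma distinct_coordsP (R : realType) (n : nat) (z : 'rV[R[i]]_n.+1) :
  distinct_coords z <->
  distinct_coords (xi_of z) /\ regular (node (xi_of z)) (z ord0 ord0).
Proof.
split=> [dz|[dxi rz] j k].
  split=> [j k|k k0]; first by rewrite !mxE => /dz/lift_inj.
  by rewrite node_xi_of //; apply: contra k0 => /eqP/dz ->.
have [->|j0] := eqVneq j ord0; have [->|k0] := eqVneq k ord0 => // zjk.
- by have := rz k k0; rewrite node_xi_of // zjk eqxx.
- by have := rz j j0; rewrite node_xi_of // zjk eqxx.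
- by apply: (node_inj dxi) => //; rewrite !node_xi_of.
Qed.

(** Moving along the first basis vector keeps [xi_of z] fixed, so both sides are limits of the same
    difference quotient. The problem thus lives in one complex variable. *)
Lemma is_derive_first (R : realType) (n : nat) (W : normedModType R[i])
    (F : 'rV[R[i]]_n.+1 -> W) (z : 'rV[R[i]]_n.+1) (dF : W) :
  is_derive z (delta_mx ord0 ord0 : 'rV[R[i]]_n.+1) F dF <->
  @is_derive R[i] (R[i] : numFieldType) W (z ord0 ord0) 1
    (fun x => F (with_first (xi_of z) x)) dF.
Proof.
have shift (h : R[i]) : h *: (delta_mx ord0 ord0 : 'rV[R[i]]_n.+1) + z =
    with_first (xi_of z) (h *: (1 : R[i]) + z ord0 ord0).
  apply/rowP => k; rewrite !mxE; case: unliftP => [j ->|->] /=.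
    by rewrite mulr0 add0r mxE.
  by [].
have E : (fun h : R[i] => h^-1 *: (F (h *: (delta_mx ord0 ord0 : 'rV[R[i]]_n.+1) + z) - F z)) =
    (fun h : R[i] => h^-1 *: (F (with_first (xi_of z) (h *: (1 : R[i]) + z ord0 ord0)) -
                    F (with_first (xi_of z) (z ord0 ord0)))).
  by apply/funext => h; rewrite shift with_first_xi_of.
by split=> /is_deriveE dF'; apply/is_deriveE; move: dF'; rewrite E.
Qed.

Definition ratmx (K : numFieldType) (n : nat) (a : 'I_n.+1 -> K) (m : nat)
    (q : 'M[{poly K}]_n.+1) (x : K) : 'M[K]_n.+1 :=
  (denom a).[x] ^- m *: evmx x q.

(** The derivative of [denom^(-m)] cancels the term [m * sum_poles] of [numerator_sol]. *)
Lemma is_derive_ratmx (K : numFieldType) (n : nat) (a : 'I_n.+1 -> K) (m : nat)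
    (r : K) (q : 'M[{poly K}]_n.+1) (x : K) :
  numerator_sol a m r q -> regular a x ->
  is_derive x 1 (ratmx a m q) (r *: (pole_matrix a x *m ratmx a m q x)).
Proof.
move=> solq ax; apply/is_derive_mxP => i j.
have Dx : (denom a ^+ m).[x] != 0 by rewrite horner_exp expf_neq0 // denom_regular.
have -> : (fun y => ratmx a m q y i j) =
    (fun y => ((denom a ^+ m).[y])^-1) * horner (q i j).
  by apply/funext => y; rewrite fctE /ratmx !mxE /horner_eval horner_exp.
have dD := is_derive_horner (denom a ^+ m) x.
have dV : is_derive x 1 (fun y => ((denom a ^+ m).[y])^-1)
    (- (denom a ^+ m).[x] ^- 2 *: (denom a ^+ m)^`().[x]).
  split; first exact: derivableV.
  by rewrite deriveV // derive_val.
apply: (is_derive_eq (is_deriveM dV (is_derive_horner (q i j) x))).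
have /matrixP/(_ i j) := solq x ax.
rewrite [LHS]mxE [dmx q i j]mxE [RHS]mxE [X in _ = X + _]mxE [X in _ = _ + X]mxE.
rewrite [evmx x q i j]mxE /horner_eval => ->.
rewrite /ratmx -scalemxAr [RHS]mxE [X in _ = _ * X]mxE deriv_denomX //.
rewrite -[(denom a).[x] ^+ m]horner_exp /GRing.scale /=; move: (denom a ^+ m).[x] Dx => D Dx.
by field.
Qed.

Lemma is_derive_trmulmx (K : numFieldType) (n : nat) (V W : K -> 'M[K]_n)
    (dV dW : 'M[K]_n) (x : K) :
  is_derive x 1 V dV -> is_derive x 1 W dW ->
  is_derive x 1 (fun y => (V y)^T *m W y) ((V x)^T *m dW + dV^T *m W x).
Proof.
move=> /is_derive_mxP hV /is_derive_mxP hW; apply/is_derive_mxP => i j.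
have -> : (fun y => ((V y)^T *m W y) i j) =
    \sum_k ((fun y => V y k i) * (fun y => W y k j)).
  apply/funext => y; rewrite mxE fct_sumE; apply: eq_bigr => k _.
  by rewrite mxE.
apply: (is_derive_eq (is_derive_sum (fun k => is_deriveM (hV k i) (hW k j)))).
rewrite !mxE -big_split /=; apply: eq_bigr => k _.
by rewrite !mxE /GRing.scale /= [W x k j * _]mulrC.
Qed.

Lemma ratmx_dual (K : numFieldType) (n : nat) (a : 'I_n.+1 -> K) (m : nat)
    (q qv : 'M[{poly K}]_n.+1) (x : K) :
  qv^T *m q = (denom a ^+ (2 * m))%:M -> regular a x ->
  ratmx a m q x *m (ratmx a m qv x)^T = 1%:M.
Proof.
move=> dual ax; apply: mulmx1C.
rewrite /ratmx -scalemxAr linearZ /= -scalemxAl (dual_evmx x dual) !scale_scalar_mx.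
have Dx : (denom a).[x] != 0 by rewrite denom_regular.
congr (_%:M); rewrite horner_exp mul2n -addnn exprD; field.
by rewrite expf_neq0.
Qed.

(** With [V] the solution for [- rho], the product [V^T W] has zero derivative, hence is constant on
    the punctured plane; and [V^T] is inverse to [ratmx a m q]. *)
Lemma matrix_solution_ratmx (R : realType) (n : nat) (rho : int)
    (W : 'rV[R[i]]_n.+1 -> 'M[R[i]]_n.+1) (xi : 'rV[R[i]]_n)
    (q qv : 'M[{poly R[i]}]_n.+1) :
  let m := `|rho|%N in let a := node xi in
  distinct_coords xi -> matrix_solution rho W ->
  numerator_sol a m (- rho%:~R) qv -> qv^T *m q = (denom a ^+ (2 * m))%:M ->
  exists C, forall z, distinct_coords z -> xi_of z = xi ->
    W z = ratmx a m q (z ord0 ord0) *m C.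
Proof.
move=> m a dxi solW solv dual.
pose V (x : R[i]) := ratmx a m qv x; pose W1 (x : R[i]) := W (with_first xi x).
pose G (x : R[i]) := (V x)^T *m W1 x.
have dG (x : R[i]) : x \notin poles a -> @is_derive R[i] (R[i] : numFieldType) _ x 1 G 0.
  move=> /regularP ax.
  have dz : distinct_coords (with_first xi x).
    by apply/distinct_coordsP; rewrite xi_of_with_first with_first0.
  have /is_derive_first := solW _ dz.
  rewrite with_first0 xi_of_with_first A1_pole_matrix xi_of_with_first with_first0 => dW.
  apply: (is_derive_eq (is_derive_trmulmx (is_derive_ratmx solv ax) dW)).
  rewrite !linearZ /= trmx_mul tr_pole_matrix -!scalemxAl -!scalemxAr scaleNr mulmxA.
  by rewrite scalerA mulrC -scalerA subrr.
have [x0 /regularP ax0] := regular_exists a.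
exists (G x0) => z /distinct_coordsP[_ rz] zxi; rewrite zxi in rz.
have -> : G x0 = G (z ord0 ord0).
  apply/matrixP => i j.
  apply: (punctured_plane_const (s := poles a) (f := fun x => G x i j)) => // [x xs|].
    by have /is_derive_mxP/(_ i j) := dG x xs; rewrite mxE.
  exact/regularP.
rewrite /G mulmxA (ratmx_dual dual) // mul1mx /W1 -zxi.
by rewrite with_first_xi_of.
Qed.

(** * Fundamental solutions and their decomposition *)

Lemma mulmx_col_sum (K : numFieldType) (n : nat) (A : 'M[K]_n) (c : 'I_n -> K) :
  \sum_j c j *: col j A = A *m \col_j c j.
Proof.
apply/colP => i; rewrite summxE mxE; apply: eq_bigr => j _.
by rewrite !mxE mulrC.
Qed.

Theorem theorem2p1 (R : realType) (n : nat) (hn : (2 <= n.+1)%N) (rho : int) :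
  (exists W : 'rV[R[i]]_n.+1 -> 'M[R[i]]_n.+1, fundamental_solution rho W) /\
  (forall W : 'rV[R[i]]_n.+1 -> 'M[R[i]]_n.+1, fundamental_solution rho W ->
     exists (L : 'I_n.+1 -> nat -> 'rV[R[i]]_n -> 'M[R[i]]_n.+1)
            (Q : 'rV[R[i]]_n -> {poly 'M[R[i]]_n.+1}),
       (forall z : 'rV[R[i]]_n.+1, distinct_coords z ->
          W z = \sum_(k : 'I_n.+1 | k != ord0) \sum_(1 <= j < `|rho|%N.+1)
                  (z ord0 ord0 - z ord0 k) ^- j *: L k j (xi_of z)
                + (Q (xi_of z)).[(z ord0 ord0)%:M]) /\
       (forall xi : 'rV[R[i]]_n, distinct_coords xi ->
          (0 < rho -> (size (Q xi)).-1 = (`|rho| * (n.+1 - 1))%N) /\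
          (rho < 0 -> (size (Q xi)).-1 = `|rho|%N))).
Proof.
pose m := `|rho|%N.
have num (xi : 'rV[R[i]]_n) : exists qq : 'M[{poly R[i]}]_n.+1 * 'M[{poly R[i]}]_n.+1,
  distinct_coords xi ->
  [/\ numerator_sol (node xi) m rho%:~R qq.1, numerator_sol (node xi) m (- rho%:~R) qq.2,
      qq.2^T *m qq.1 = (denom (node xi) ^+ (2 * m))%:M,
      0 < rho -> max_degree qq.1 (m * n + m * n) & rho < 0 -> max_degree qq.1 (m * n + m)].
  have [dxi|ndxi] := pselect (distinct_coords xi); last by exists (0, 0).
  by have [q [qv h]] := numerator_rho rho (node_inj dxi) hn; exists (q, qv).
have /choice[qq hqq] := num.
split.
  (* The derivative is along [z_1], so the numerators may be chosen separately for each [xi]. *)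
  exists (fun z => ratmx (node (xi_of z)) m (qq (xi_of z)).1 (z ord0 ord0)); split.
    move=> z /distinct_coordsP[dxi rz]; have [sol _ _ _ _] := hqq _ dxi.
    apply/is_derive_first; rewrite A1_pole_matrix -scalemxAl.
    under [X in is_derive _ _ X]funext => x do rewrite xi_of_with_first with_first0.
    exact: is_derive_ratmx.
  move=> xi dxi c hc; have [_ _ dual _ _] := hqq _ dxi.
  have [x0 ax0] := regular_exists (node xi).
  have := hc (with_first xi x0); rewrite xi_of_with_first with_first0 mulmx_col_sum.
  have dz : distinct_coords (with_first xi x0).
    by apply/distinct_coordsP; rewrite xi_of_with_first with_first0.
  move=> /(_ dz erefl)/(congr1 (mulmx (ratmx (node xi) m (qq xi).2 x0)^T)).
  rewrite mulmxA (mulmx1C (ratmx_dual dual ax0)) mul1mx mulmx0 => c0 j.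
  by have /colP/(_ j) := c0; rewrite !mxE.
move=> W [solW indW].
pose P xi (LQ : ('I_n.+1 -> nat -> 'M[R[i]]_n.+1) * {poly 'M[R[i]]_n.+1}) :=
  distinct_coords xi ->
  (forall z, distinct_coords z -> xi_of z = xi ->
     W z = \sum_(k | k != ord0) \sum_(1 <= j < m.+1)
             (z ord0 ord0 - z ord0 k) ^- j *: LQ.1 k j + LQ.2.[(z ord0 ord0)%:M]) /\
  ((0 < rho -> size LQ.2 = (m * n).+1) /\ (rho < 0 -> size LQ.2 = m.+1)).
suff /choice[LQ hLQ] xi : exists LQ, P xi LQ.
  exists (fun k j xi => (LQ xi).1 k j), (fun xi => (LQ xi).2); split.
    by move=> z dz; have /distinct_coordsP[dxi _] := dz; have [+ _] := hLQ _ dxi; apply.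
  move=> xi dxi; have [_ [h1 h2]] := hLQ _ dxi.
  by split=> [/h1|/h2] ->; rewrite ?subn1.
have [dxi|ndxi] := pselect (distinct_coords xi); last by exists (fun _ _ => 0, 0).
set a := node xi; have [sol solv dual sp sn] := hqq _ dxi.
set q := (qq xi).1 in sol dual sp sn; set qv := (qq xi).2 in solv dual.
have [C WC] := matrix_solution_ratmx dxi solW solv dual.
(* A kernel vector of [C] would be a linear relation between the columns of [W]; transposing turns
   the left kernel of [det0P] into a right one. *)
have Cu : C \in unitmx.
  rewrite -unitmx_tr unitmxE unitfE; apply/negP => /det0P[v v0 vC].
  case/negP: v0; apply/eqP/rowP => j; rewrite [RHS]mxE.
  apply: (indW xi dxi (fun j => v ord0 j)) => z dz zxi.
  rewrite mulmx_col_sum (_ : \col_j _ = v^T); last by apply/colP => i; rewrite !mxE.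
  rewrite WC // -mulmxA -[C *m _]trmxK trmx_mul trmxK vC trmx0 mulmx0 //.
pose qC := q *m map_mx polyC C.
have WE z : distinct_coords z -> xi_of z = xi -> W z = ratmx a m qC (z ord0 ord0).
  move=> dz zxi; rewrite WC // /ratmx -scalemxAl; congr (_ *: _).
  rewrite /qC evmxM; congr (_ *m _); apply/matrixP => i j.
  by rewrite !mxE /horner_eval hornerC.
have pf (ij : 'I_n.+1 * 'I_n.+1) := partial_fraction_denom m (qC ij.1 ij.2) (node_inj dxi).
have /choice[c hc] := pf.
pose Qm := map_mx (fun p => p %/ denom a ^+ m) qC.
(* For [rho = 0] no degree is prescribed, and [d] is a bound on the sizes of the entries. *)
pose d := if 0 < rho then (m * n)%N else if rho < 0 then m else \max_i \max_j size (Qm i j).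
have sQ : (0 < rho) || (rho < 0) -> max_degree Qm d.
  rewrite /d; case: ifP => [r0 _|_ /= r0].
    by apply: max_degree_divp; apply: max_degree_mulr => //; apply: sp.
  by rewrite r0; apply: max_degree_divp; apply: max_degree_mulr => //; apply: sn.
have dQ i j : (size (Qm i j) <= d.+1)%N.
  case: (boolP ((0 < rho) || (rho < 0))) => [/sQ[+ _]|]; first exact.
  rewrite negb_or /d => /andP[/negbTE -> /negbTE ->].
  apply: leqW; apply: leq_trans (leq_bigmax i); exact: leq_bigmax.
exists (fun k j => \matrix_(i, l) c (i, l) k j, polymx d Qm) => _; split=> /=.
  move=> z dz zxi; have /distinct_coordsP[_ rz] := dz; rewrite zxi -/a in rz.
  rewrite WE // horner_polymx //; apply/matrixP => i l.
  rewrite [RHS]mxE summxE /ratmx mxE mxE mulrC (hc (i, l) _ rz) !mxE; congr (_ + _).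
  apply: eq_bigr => k k0; rewrite summxE; apply: eq_bigr => j _.
  by rewrite !mxE -(node_xi_of z k0) zxi.
split=> r0.
  by rewrite size_polymx; [rewrite /d r0 | apply: sQ; rewrite r0].
rewrite size_polymx; last by apply: sQ; rewrite r0 orbT.
by rewrite /d r0 ltNge (ltW r0).
Qed.
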